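(* Let $S$ be a smooth cubic surface, $l$ a line on $S$, and let $f:X_{S,l}\to\mathbb{P}^1$ be the elliptic fibration on the associated K3 surface. Let $C$ be the Matsumoto–Terasoma curve associated to $(S,l)$. Then the pull-back of $X_{S,l}$ along the base change $C\to\mathbb{P}^1$, $(v,x)\mapsto x^2$, is birationally equivalent to the product $C\times E$, where $E$ is the elliptic curve with $j=0$: $E\cong\mathbb{C}/(\mathbb{Z}+\mathbb{Z}\zeta_3)$, $\zeta_3=e^{2\pi i/3}$.
   Context: Work over $\mathbb{C}$. For a smooth cubic surface $S\subset\mathbb{P}^3$ and a line $l\subset S$, let $F_5(y_0,y_1)$ (degree 5) and $F_2(y_0,y_1)$ (degree 2) be the binary forms whose zeros are, respectively, the points of the pencil of planes through $l$ for which the residual conic is singular, and the branch points of the degree 2 map $l\to\mathbb{P}^1$ given by that pencil of conics. $X_{S,l}$ is the minimal nonsingular model of the double cover of $\mathbb{P}^2$ branched along the sextic $y_2\bigl(F_2(y_0,y_1)y_2^3+F_5(y_0,y_1)\bigr)=0$, a K3 surface, and $f:X_{S,l}\to\mathbb{P}^1$ is the elliptic fibration given by the pencil of lines through $(0,0,1)$, i.e. by the rational function $t=y_1/y_0$; it has Weierstrass form $y^2+x^3+F_5(t_0,t_1)^2F_2(t_0,t_1)=0$. Choose coordinates on $\mathbb{P}^1$ such that $F_2(y_0,y_1)=y_0y_1$ and put $f_0(u)=F_5(1,u)$ (a polynomial of degree 5 as long as $y_0$ does not divide $F_5$). The Matsumoto–Terasoma curve $C$ is the smooth projective model of the affine curve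 $v^3-xf_0(x^2)=0$. *)

(* Defs.v *)
From mathcomp Require Import all_boot all_order all_algebra.
From mathcomp Require Import classical_sets reals.
From mathcomp Require Import complex.
From mathcomp Require Import mpoly.

Set Implicit Arguments.
Unset Strict Implicit.
Unset Printing Implicit Defensive.

Import GRing.Theory.
Local Open Scope ring_scope.
Local Open Scope classical_set_scope.

(* A point of P^(n-1) is a nonzero row vector of length n up to a nonzero
   scalar; a subset of P^(n-1) is a set of nonzero row vectors stable under
   nonzero scalars. *)
Section QuasiProjective.
Variable K : fieldType.

Definition same_point n (x y : 'rV[K]_n) : Prop :=
  exists2 k : K, k != 0 & y = k *: x.

Definition homogeneous n (p : {mpoly K[n]}) : Prop :=
  exists d : nat, p \is d.-homog.

Definition proj_closed n (Z : set 'rV[K]_n) : Prop :=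
  exists2 T : set {mpoly K[n]}, (forall p, T p -> homogeneous p) &
    Z = [set x : 'rV[K]_n | x != 0 /\ forall p, T p -> p.@[x 0] = 0].

Definition open_in n (V U : set 'rV[K]_n) : Prop :=
  exists2 Z, proj_closed Z & U = V `\` Z.

Definition dense_open n (V U : set 'rV[K]_n) : Prop :=
  open_in V U /\ forall W, open_in V W -> W !=set0 -> (U `&` W) !=set0.

Definition irreducible n (V : set 'rV[K]_n) : Prop :=
  V !=set0 /\ forall A B, proj_closed A -> proj_closed B ->
    V `<=` A `|` B -> V `<=` A \/ V `<=` B.

(* Near p, phi is given by forms g_j of the same degree without common zero.
   Requiring phi = g wherever g does not vanish, instead of on some open
   neighbourhood of p only, is no restriction: multiply g by a form that
   vanishes off the neighbourhood but not at p. *)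
Definition morphism n m (V : set 'rV[K]_n) (W : set 'rV[K]_m)
    (phi : 'rV[K]_n -> 'rV[K]_m) : Prop :=
  (forall x, V x -> W (phi x)) /\
  forall p, V p -> exists (d : nat) (g : 'I_m -> {mpoly K[n]}),
    let g_at x : 'rV[K]_m := \row_j (g j).@[x 0] in
    [/\ forall j, g j \is d.-homog, g_at p != 0 &
        forall x, V x -> g_at x != 0 -> same_point (g_at x) (phi x)].

Definition mutually_inverse n m (V : set 'rV[K]_n) (W : set 'rV[K]_m)
    (phi : 'rV[K]_n -> 'rV[K]_m) (psi : 'rV[K]_m -> 'rV[K]_n) : Prop :=
  [/\ morphism V W phi, morphism W V psi,
      forall x, V x -> same_point x (psi (phi x)) &
      forall y, W y -> same_point y (phi (psi y))].

Definition isomorphism n m (V : set 'rV[K]_n) (W : set 'rV[K]_m)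
    (phi : 'rV[K]_n -> 'rV[K]_m) : Prop :=
  exists psi, mutually_inverse V W phi psi.

(* phi, defined on U, represents a birational map from V to W *)
Definition birational_map n m (V : set 'rV[K]_n) (W : set 'rV[K]_m)
    (U : set 'rV[K]_n) (phi : 'rV[K]_n -> 'rV[K]_m) : Prop :=
  dense_open V U /\ exists2 U', dense_open W U' & isomorphism U U' phi.

Definition birational n m (V : set 'rV[K]_n) (W : set 'rV[K]_m) : Prop :=
  exists U phi, birational_map V W U phi.

(* T spans the tangent space at x of the affine cone over V *)
Definition tangent_cone_basis n d (V : set 'rV[K]_n) (x : 'rV[K]_n)
    (T : 'M[K]_(d.+1, n)) : Prop :=
  row_free T /\ forall v : 'rV[K]_n, (v <= T)%MS <->
    forall p, homogeneous p -> (forall z, V z -> p.@[z 0] = 0) ->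
      \sum_i (p^`M(i)).@[x 0] * v 0 i = 0.

Definition nonsingular_projective n (d : nat) (V : set 'rV[K]_n) : Prop :=
  [/\ proj_closed V, irreducible V &
      forall x, V x -> exists T : 'M[K]_(d.+1, n), tangent_cone_basis V x T].

Definition minimal_surface n (X : set 'rV[K]_n) : Prop :=
  nonsingular_projective 2 X /\
  forall m (X' : set 'rV[K]_m) r, nonsingular_projective 2 X' ->
    morphism X X' r -> (exists U, birational_map X X' U r) ->
    isomorphism X X' r.

Definition P1 : set 'rV[K]_2 := [set y : 'rV[K]_2 | y != 0].

Definition segre n m (x : 'rV[K]_n) (y : 'rV[K]_m) : 'rV[K]_(n * m) :=
  mxvec (x^T *m y).

Definition prod_variety n m (V : set 'rV[K]_n) (W : set 'rV[K]_m) :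
    set 'rV[K]_(n * m) :=
  [set z | exists x y, [/\ V x, W y & z = segre x y]].

Definition pullback n m (V : set 'rV[K]_n) (f : 'rV[K]_n -> 'rV[K]_2)
    (W : set 'rV[K]_m) (h : 'rV[K]_m -> 'rV[K]_2) : set 'rV[K]_(n * m) :=
  [set z | exists x y,
    [/\ V x, W y, same_point (f x) (h y) & z = segre x y]].

End QuasiProjective.

Section CubicSurface.
Variable K : fieldType.
Implicit Types (G : {mpoly K[4]}) (L M : 'M[K]_(2, 4)).

Definition singular_point n (p : {mpoly K[n]}) (x : 'rV[K]_n) : Prop :=
  [/\ x != 0, p.@[x 0] = 0 & forall i, (p^`M(i)).@[x 0] = 0].

Definition smooth_cubic_surface G : Prop :=
  G \is 3.-homog /\ forall x, ~ singular_point G x.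

(* The line is the projectivized row space of L. *)
Definition line_on G L : Prop :=
  row_free L /\ forall q : 'rV[K]_2, G.@[(q *m L) 0] = 0.

(* A matrix M completing L to a basis gives the coordinates y on the pencil of
   planes through the line: y is the plane spanned by the line and y *m M.
   On that plane (s, q0, q1) are the coordinates of
   s *: (y *m M) + (q0, q1) *m L, and the line is s = 0. *)
Definition pencil_coordinates L M : Prop := row_free (col_mx M L).

Definition plane_point L M (y : 'rV[K]_2) (v : 'rV[K]_3) : 'rV[K]_4 :=
  v *m (col_mx (y *m M) L : 'M[K]_(3, 4)).

Definition residual_conic G L M (y : 'rV[K]_2) (Q : {mpoly K[3]}) : Prop :=
  forall v : 'rV[K]_3, G.@[(plane_point L M y v) 0] = v 0 0 * Q.@[v 0].

Definition singular_fibre G L M (y : 'rV[K]_2) : Prop :=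
  exists2 Q, residual_conic G L M y Q & exists v, singular_point Q v.

(* The degree 2 map from the line to P^1 sends a point to the member of the
   pencil whose residual conic contains it, so its fibre over y is the
   intersection of the line with that conic. *)
Definition fibre_on_line (Q : {mpoly K[3]}) : set 'rV[K]_3 :=
  [set v : 'rV[K]_3 | [/\ v != 0, v 0 0 = 0 & Q.@[v 0] = 0]].

Definition branch_point G L M (y : 'rV[K]_2) : Prop :=
  exists2 Q, residual_conic G L M y Q &
    exists2 v, fibre_on_line Q v &
      forall w, fibre_on_line Q w -> same_point v w.

(* For a smooth cubic surface there are 2 branch points and 5 singular fibres,
   so the forms below have simple zeros and are determined up to scalars. *)
Definition form_with_zeros (d : nat) (F : {mpoly K[2]})
    (P : 'rV[K]_2 -> Prop) : Prop :=
  [/\ F \is d.-homog, F != 0 &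
      forall y : 'rV[K]_2, y != 0 -> (F.@[y 0] = 0 <-> P y)].

Definition pencil_forms G L M (F2 F5 : {mpoly K[2]}) : Prop :=
  form_with_zeros 2 F2 (branch_point G L M) /\
  form_with_zeros 5 F5 (singular_fibre G L M).

(* The double plane w^2 = y2 (F2(y0,y1) y2^3 + F5(y0,y1)) in P(1,1,1,3), with
   y = (y0,y1), embedded by O(3): all cubic monomials in (y0,y1,y2), and w. *)
Definition double_plane_point (y : 'rV[K]_2) (y2 w : K) :
    'rV[K]_(3 * (3 * 3) + 1) :=
  let p : 'rV[K]_3 := row_mx y y2%:M in
  row_mx (segre p (segre p p)) w%:M.

Definition double_plane (F2 F5 : {mpoly K[2]}) : set 'rV[K]_(3 * (3 * 3) + 1) :=
  [set z | exists (y : 'rV[K]_2) (y2 w : K),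
    [/\ (y != 0) || (y2 != 0),
        w ^+ 2 = y2 * (F2.@[y 0] * y2 ^+ 3 + F5.@[y 0]) &
        same_point (double_plane_point y y2 w) z]].

(* X is the minimal nonsingular model of the double plane, and f is the
   morphism extending the rational function t = y1 / y0. *)
Definition elliptic_K3 n (F2 F5 : {mpoly K[2]}) (X : set 'rV[K]_n)
    (f : 'rV[K]_n -> 'rV[K]_2) : Prop :=
  [/\ minimal_surface X, morphism X (@P1 K) f &
      exists U pi, birational_map X (double_plane F2 F5) U pi /\
        forall p y y2 w, U p -> y != 0 ->
          same_point (double_plane_point y y2 w) (pi p) ->
          same_point y (f p)].

Definition f0 (F5 : {mpoly K[2]}) (u : K) : K := F5.@[(row_mx 1%:M u%:M : 'rV[K]_2) 0].

Definition affine_point2 (v x : K) : 'rV[K]_3 := \row_i [:: 1; v; x]`_i.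

Definition affine_MT_curve (F5 : {mpoly K[2]}) : set 'rV[K]_3 :=
  [set z | exists v x : K, v ^+ 3 - x * f0 F5 (x ^+ 2) = 0 /\
    same_point (affine_point2 v x) z].

(* C is the smooth projective model of the affine curve, and h is the morphism
   extending (v, x) |-> x^2. *)
Definition Matsumoto_Terasoma n (F5 : {mpoly K[2]}) (C : set 'rV[K]_n)
    (h : 'rV[K]_n -> 'rV[K]_2) : Prop :=
  [/\ nonsingular_projective 1 C, morphism C (@P1 K) h &
      exists U kappa, birational_map C (affine_MT_curve F5) U kappa /\
        forall c v x, U c -> same_point (affine_point2 v x) (kappa c) ->
          same_point (row_mx 1%:M (x ^+ 2)%:M) (h c)].

(* The elliptic curve y^2 = x^3 + a x + b in the plane; over the complex numbers
   every elliptic curve has this form, and its isomorphism class is determined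
   by j. The one with j = 0 is the complex torus C / (Z + Z zeta_3). *)
Definition weierstrass_cubic (a b : K) : set 'rV[K]_3 :=
  [set z | exists x y w : K, [/\ z = \row_i [:: x; y; w]`_i, z != 0 &
    y ^+ 2 * w = x ^+ 3 + a * x * w ^+ 2 + b * w ^+ 3]].

Definition weierstrass_disc (a b : K) : K := - 16 * (4 * a ^+ 3 + 27 * b ^+ 2).

Definition j_invariant (a b : K) : K :=
  - 1728 * (4 * a) ^+ 3 / weierstrass_disc a b.

End CubicSurface.

(* Main.v *)
(* Over a point (v, x) of the Matsumoto-Terasoma curve, v^3 = x f0(x^2), the
   double plane w^2 = y2 (x^2 y2^3 + f0(x^2)) becomes Y^2 = X^3 + b under
   X = beta^2 v / (x y2), Y = beta^3 w / (x y2^2), where beta^6 = b; these formulas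
   and their inverse define the birational map on explicit open subsets.

   The domain must moreover be dense in the pull-back, i.e. the fibres of f over
   the excluded points must contribute no component.  A form in (p, c) is a
   pairing of two vectors, one depending on p and one on c.  The vectors attached
   to the points of C over u span a rational family of subspaces, which extends
   over every point of the line P^1; comparing with this extension on both factors
   shows that a form vanishing on the domain vanishes on the whole pull-back. *)
Require Import Defs.
From mathcomp Require Import all_boot all_order all_algebra.
From mathcomp Require Import boolp classical_sets reals.
From mathcomp Require Import complex.
From mathcomp Require Import mpoly.
From mathcomp Require Import ring.

Set Implicit Arguments.
Unset Strict Implicit.
Unset Printing Implicit Defensive.

Import GRing.Theory Num.Theory.
Local Open Scope ring_scope.
Local Open Scope classical_set_scope.

(** The curve is made to trivialise a twist. With F2 = y0 y1 the coefficient F5^2 F2 of the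
    Weierstrass form is u f0(u)^2, and the substitutions u = x^2, f0(x^2) = v^3 / x turn it into
    v^6, a sixth power. The formulas for X and Y come from dividing w^2 = x^2 y2^4 + (v^3 / x) y2 by
    x^2 y2^4. The obstacle is density: X and C are known only through birational models, the fibres
    of f outside the explicit open set are unknown, and the pull-back is a set-theoretic fibre
    product not known in advance to be irreducible. The extension of subspaces over the line stands
    in for a flatness argument. It uses only that a form vanishing on a nonempty open subset of X or
    of C vanishes everywhere, which is why open sets, morphisms and irreducibility are all rephrased
    through forms. *)

Lemma row_neq0P (V : nmodType) n (x : 'rV[V]_n) : x != 0 -> exists j, x 0 j != 0.
Proof.
move=> nx; apply: contrapT => nex; case/eqP: nx; apply/rowP => j; rewrite mxE.
by apply/eqP/negbNE/negP => xj; apply: nex; exists j.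
Qed.

Lemma row_neq0 (V : nmodType) n (x : 'rV[V]_n) j : x 0 j != 0 -> x != 0.
Proof. by apply: contraNN => /eqP ->; rewrite mxE. Qed.

(** * Forms as functions on row vectors, and points up to a scalar *)

Section Forms.
Variable K : fieldType.

(** Forms are kept as functions, with the polynomial only asserted to exist, so that products and
    composites are written directly and compared pointwise. *)
Definition is_form n d (F : 'rV[K]_n -> K) : Prop :=
  exists2 P : {mpoly K[n]}, P \is d.-homog & forall x, F x = P.@[x 0].

Definition form_map n m d (g : 'rV[K]_n -> 'rV[K]_m) : Prop :=
  forall j, is_form d (fun x => g x 0 j).

Lemma form_ext n d (F G : 'rV[K]_n -> K) :
  is_form d F -> G =1 F -> is_form d G.
Proof. by case=> P hP FE GE; exists P => // x; rewrite GE FE. Qed.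

Lemma form_coord n (i : 'I_n) : is_form 1 (fun x : 'rV[K]_n => x 0 i).
Proof. by exists 'X_i => [|x]; rewrite ?mevalXU // dhomogX /= mdeg1. Qed.

Lemma form_const n c : is_form 0 (fun _ : 'rV[K]_n => c).
Proof.
exists c%:MP => [|x]; last by rewrite mevalC.
by rewrite -[c%:MP]mulr1 mul_mpolyC dhomogZ // dhomog1.
Qed.

Lemma form0 n d : is_form d (fun _ : 'rV[K]_n => 0).
Proof. by exists 0 => [|x]; rewrite ?dhomog0 // meval0. Qed.

Lemma formD n d (F G : 'rV[K]_n -> K) :
  is_form d F -> is_form d G -> is_form d (fun x => F x + G x).
Proof.
case=> P hP FE [Q hQ GE]; exists (P + Q); first exact: dhomogD.
by move=> x; rewrite mevalD FE GE.
Qed.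

Lemma formM n d e (F G : 'rV[K]_n -> K) :
  is_form d F -> is_form e G -> is_form (d + e) (fun x => F x * G x).
Proof.
case=> P hP FE [Q hQ GE]; exists (P * Q); first exact: dhomogM.
by move=> x; rewrite mevalM FE GE.
Qed.

Lemma formZ n d c (F : 'rV[K]_n -> K) :
  is_form d F -> is_form d (fun x => c * F x).
Proof. exact: formM (form_const n c). Qed.

Lemma formX n d k (F : 'rV[K]_n -> K) :
  is_form d F -> is_form (d * k) (fun x => F x ^+ k).
Proof.
case=> P hP FE; exists (P ^+ k); first exact: dhomogMn.
by move=> x; rewrite rmorphXn /= FE.
Qed.

Lemma form_sum n d (I : eqType) (r : seq I) (F : I -> 'rV[K]_n -> K) :
  (forall i, i \in r -> is_form d (F i)) ->
  is_form d (fun x => \sum_(i <- r) F i x).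
Proof.
elim: r => [_|i r IH hF].
  by apply: form_ext (form0 n d) _ => x; rewrite big_nil.
apply: form_ext (formD (hF i (mem_head _ _)) (IH _)) _ => [j jr|x].
  by apply: hF; rewrite inE jr orbT.
by rewrite big_cons.
Qed.

Lemma form_prod n (I : Type) (r : seq I) (d : I -> nat)
    (F : I -> 'rV[K]_n -> K) :
  (forall i, is_form (d i) (F i)) ->
  is_form (\sum_(i <- r) d i) (fun x => \prod_(i <- r) F i x).
Proof.
move=> hF; elim: r => [|i r IH].
  by rewrite big_nil; apply: form_ext (form_const n 1) _ => x; rewrite big_nil.
rewrite big_cons; apply: form_ext (formM (hF i) IH) _ => x.
by rewrite big_cons.
Qed.

Lemma form_comp n m d e (F : 'rV[K]_m -> K) (g : 'rV[K]_n -> 'rV[K]_m) :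
  is_form d F -> form_map e g -> is_form (d * e) (fun x => F (g x)).
Proof.
case=> P hP FE hg.
apply: (@form_ext _ _ (fun x => \sum_(a <- msupp P) P@_a *
  \prod_(i < m) (g x) 0 i ^+ a i)); last by move=> x; rewrite FE mevalE.
apply: form_sum => a aP; apply: formZ.
have adeg : mdeg a = d := dhomog_mf hP aP.
have -> : (d * e = \sum_(i <- index_enum 'I_m) e * a i)%N.
  by rewrite -big_distrr /= -mdegE adeg mulnC.
by apply: form_prod => i; apply: formX.
Qed.

Lemma form_scale n d (F : 'rV[K]_n -> K) k x :
  is_form d F -> F (k *: x) = k ^+ d * F x.
Proof.
case=> P hP FE; rewrite !FE !mevalE mulr_sumr.
apply: eq_big_seq => a aP; rewrite mulrCA; congr (_ * _).
have adeg : mdeg a = d := dhomog_mf hP aP.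
rewrite -adeg mdegE expr_sum -big_split /=.
by apply: eq_bigr => i _; rewrite mxE exprMn.
Qed.

Lemma form_map_scale n m d (g : 'rV[K]_n -> 'rV[K]_m) k x :
  form_map d g -> g (k *: x) = k ^+ d *: g x.
Proof. by move=> hg; apply/rowP => j; rewrite mxE (form_scale k x (hg j)). Qed.

Lemma same_refl n (x : 'rV[K]_n) : same_point x x.
Proof. by exists 1; rewrite ?oner_eq0 // scale1r. Qed.

Lemma same_sym n (x y : 'rV[K]_n) : same_point x y -> same_point y x.
Proof.
by case=> k k0 ->; exists k^-1; rewrite ?invr_eq0 // scalerA mulVf ?scale1r.
Qed.

Lemma same_trans n (x y z : 'rV[K]_n) :
  same_point x y -> same_point y z -> same_point x z.
Proof.
by case=> k k0 -> [l l0 ->]; exists (l * k); rewrite ?mulf_neq0 // scalerA.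
Qed.

Lemma same_scale n k (x : 'rV[K]_n) : k != 0 -> same_point x (k *: x).
Proof. by exists k. Qed.

Lemma same_neq0 n (x y : 'rV[K]_n) : same_point x y -> x != 0 -> y != 0.
Proof. by case=> k k0 -> x0; rewrite scaler_eq0 negb_or k0. Qed.

Lemma same_form n d (F : 'rV[K]_n -> K) x y :
  is_form d F -> same_point x y -> F x != 0 -> F y != 0.
Proof.
by move=> hF [k k0 ->] Fx; rewrite (form_scale _ _ hF) mulf_neq0 ?expf_neq0.
Qed.

Lemma same_form_map n m d (g : 'rV[K]_n -> 'rV[K]_m) x y :
  form_map d g -> same_point x y -> same_point (g x) (g y).
Proof.
move=> hg [k k0 ->]; rewrite (form_map_scale k x hg).
exact/same_scale/expf_neq0.
Qed.

End Forms.

(** * Zariski topology, morphisms and irreducibility tested by single forms *)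

Section Morphisms.
Variable K : fieldType.

Definition nonzero_set n (V : set 'rV[K]_n) : Prop := forall x, V x -> x != 0.

Definition cone n (V : set 'rV[K]_n) : Prop :=
  forall x y, same_point x y -> V x -> V y.

Definition locally_open n (V U : set 'rV[K]_n) : Prop :=
  (forall x, U x -> V x) /\
  forall p, U p -> exists d F,
    [/\ is_form d F, F p != 0 & forall x, V x -> F x != 0 -> U x].

Definition locally_forms n m (V : set 'rV[K]_n) (phi : 'rV[K]_n -> 'rV[K]_m)
    p : Prop :=
  exists d g, [/\ form_map d g, g p != 0 &
    forall x, V x -> g x != 0 -> same_point (g x) (phi x)].

(** This is irreducibility restricted to basic open sets; in this form it passes to products and
    along birational maps without handling closed sets. *)
Definition form_irreducible n (V : set 'rV[K]_n) : Prop :=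
  forall d F e G, is_form d F -> is_form e G ->
    (exists2 x, V x & F x != 0) -> (exists2 x, V x & G x != 0) ->
    exists x, [/\ V x, F x != 0 & G x != 0].

Lemma open_inP n (V U : set 'rV[K]_n) :
  nonzero_set V -> open_in V U <-> locally_open V U.
Proof.
move=> nV; split=> [[Z [T hT ->] ->]|[UV hU]].
  split=> [x []//|p [Vp nZ]].
  have [P [TP nP]] : exists P, T P /\ P.@[p 0] <> 0.
    apply: contrapT => nex; apply: nZ; split; first exact: nV.
    by move=> P TP; apply: contrapT => nP; apply: nex; exists P.
  have [d hd] := hT P TP; exists d, (fun x => P.@[x 0]).
  split=> //; [by exists P | exact/eqP |].
  by move=> x Vx Px; split=> // -[_ /(_ P TP) P0]; rewrite P0 eqxx in Px.
(* The complement is cut out by every form whose nonvanishing locus in [V] lies inside [U]; local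
   openness at a point of [U] supplies such a form that is nonzero there. *)
pose T := [set P : {mpoly K[n]} | homogeneous P /\
   forall x, V x -> P.@[x 0] != 0 -> U x].
exists [set x : 'rV[K]_n | x != 0 /\ forall P, T P -> P.@[x 0] = 0].
  by exists T => // P [].
apply/seteqP; split=> x /=.
  move=> Ux; split; first exact: UV.
  case=> _ vanish; have [d [F [[P hP FE] Fx FU]]] := hU x Ux.
  move: Fx; rewrite FE vanish ?eqxx //; split; first by exists d.
  by move=> y Vy; rewrite -FE; exact: FU.
case=> Vx nv; apply: contrapT => nUx; apply: nv; split; first exact: nV.
by move=> P [_ PU]; apply: contrapT => /eqP nP; apply/nUx/PU.
Qed.

Lemma morphismP n m (V : set 'rV[K]_n) (W : set 'rV[K]_m) phi :
  morphism V W phi <->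
  (forall x, V x -> W (phi x)) /\ forall p, V p -> locally_forms V phi p.
Proof.
split=> -[VW hphi]; split=> // p Vp.
  have [d [g [hg gp gphi]]] := hphi p Vp.
  exists d, (fun x => \row_j (g j).@[x 0]); split=> // j.
  by exists (g j) => // x; rewrite mxE.
have [d [g [hg gp gphi]]] := hphi p Vp.
have hP j : {P : {mpoly K[n]} | P \is d.-homog /\ forall x, g x 0 j = P.@[x 0]}.
  by apply: cid; have [P] := hg j; exists P.
have gE (x : 'rV[K]_n) : \row_j (sval (hP j)).@[x 0] = g x.
  by apply/rowP => j; rewrite mxE; case: (svalP (hP j)) => _ ->.
exists d, (fun j => sval (hP j)) => g_at; split.
- by move=> j; case: (svalP (hP j)).
- by rewrite /g_at gE.
- by move=> x Vx; rewrite /g_at gE; exact: gphi.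
Qed.

Lemma morphism_maps n m (V : set 'rV[K]_n) (W : set 'rV[K]_m) phi x :
  morphism V W phi -> V x -> W (phi x).
Proof. by case=> VW _; exact: VW. Qed.

Lemma morphism_restrict n m (V V' : set 'rV[K]_n) (W W' : set 'rV[K]_m) phi :
  morphism V W phi -> (forall x, V' x -> V x) ->
  (forall x, V' x -> W' (phi x)) -> morphism V' W' phi.
Proof.
move=> /morphismP[_ hphi] V'V V'W'; apply/morphismP; split=> // p /V'V Vp.
have [d [g [hg gp gphi]]] := hphi p Vp.
by exists d, g; split=> // x /V'V; exact: gphi.
Qed.

Lemma form_morphism n m d (V : set 'rV[K]_n) (W : set 'rV[K]_m) g :
  form_map d g -> nonzero_set W -> (forall x, V x -> W (g x)) ->
  morphism V W g.
Proof.
move=> hg nW VW; apply/morphismP; split=> // p Vp; exists d, g.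
by split=> //; [exact/nW/VW | move=> x _ _; exact: same_refl].
Qed.

Lemma morphism_same n m (V : set 'rV[K]_n) (W : set 'rV[K]_m) phi x y :
  morphism V W phi -> V x -> V y -> same_point x y ->
  same_point (phi x) (phi y).
Proof.
move=> /morphismP[_ hphi] Vx Vy xy.
have [d [g [hg gx gphi]]] := hphi x Vx.
have gxy := same_form_map hg xy.
apply: same_trans (same_sym (gphi x Vx gx)) (same_trans gxy (gphi y Vy _)).
exact: same_neq0 gxy gx.
Qed.

Lemma morphism_comp n m p (V : set 'rV[K]_n) (W : set 'rV[K]_m)
    (Y : set 'rV[K]_p) phi psi :
  morphism V W phi -> morphism W Y psi ->
  morphism V Y (fun x => psi (phi x)).
Proof.
move=> /morphismP[VW hphi] /morphismP[WY hpsi]; apply/morphismP.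
split=> [x Vx|x Vx]; first exact/WY/VW.
have [d [g [hg gx gphi]]] := hphi x Vx.
have [e [k [hk kx kpsi]]] := hpsi (phi x) (VW x Vx).
have gE y : V y -> g y != 0 -> same_point (k (g y)) (k (phi y)).
  by move=> Vy gy; exact: same_form_map hk (gphi y Vy gy).
have [j gj] := row_neq0P gx.
(* The factor [g y 0 j] matters when [k] has degree 0: [k (g y)] may then be nonzero at zeros of
   [g], where [g] says nothing about [phi]. *)
exists (d + e * d)%N, (fun y => g y 0 j *: k (g y)); split.
- move=> i; apply: form_ext (formM (hg j) (form_comp (hk i) hg)) _ => y.
  by rewrite mxE.
- rewrite scaler_eq0 negb_or gj; exact: same_neq0 (same_sym (gE x Vx gx)) kx.
- move=> y Vy; rewrite scaler_eq0 negb_or => /andP[gyj ky].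
  have gy := row_neq0 gyj.
  apply: same_trans (same_sym (same_scale _ gyj)) (same_trans (gE y Vy gy) _).
  by apply: kpsi; [exact: VW | exact: same_neq0 (gE y Vy gy) ky].
Qed.

Lemma preimage_open n m (V : set 'rV[K]_n) (W U : set 'rV[K]_m) phi :
  morphism V W phi -> locally_open W U ->
  locally_open V [set x | V x /\ U (phi x)].
Proof.
move=> /morphismP[VW hphi] [UW hU]; split=> [x []//|p [Vp Up]].
have [d [g [hg gp gphi]]] := hphi p Vp.
have [e [F [hF Fp FU]]] := hU _ Up.
have [j gj] := row_neq0P gp.
exists (d + e * d)%N, (fun x => g x 0 j * F (g x)); split.
- exact: formM (hg j) (form_comp hF hg).
- rewrite mulf_neq0 //.
  exact: same_form hF (same_sym (gphi p Vp gp)) Fp.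
- move=> x Vx; rewrite mulf_eq0 negb_or => /andP[/row_neq0 gx Fgx].
  split=> //; apply: FU; first exact: VW.
  exact: same_form hF (gphi x Vx gx) Fgx.
Qed.

Lemma locally_open_trans n (V U W : set 'rV[K]_n) :
  locally_open V U -> locally_open U W -> locally_open V W.
Proof.
move=> [UV hU] [WU hW]; split=> [x /WU/UV//|p Wp].
have [d [F [hF Fp FU]]] := hU p (WU p Wp).
have [e [G [hG Gp GW]]] := hW p Wp.
exists (d + e)%N, (fun x => F x * G x); split; first exact: formM.
  exact: mulf_neq0.
move=> x Vx; rewrite mulf_eq0 negb_or => /andP[Fx Gx].
by apply: GW => //; exact: FU.
Qed.

Lemma locally_openI n (V U W : set 'rV[K]_n) :
  locally_open V U -> locally_open V W ->
  locally_open V [set x | U x /\ W x].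
Proof.
move=> [UV hU] [WV hW]; split=> [x [/UV]//|p [Up Wp]].
have [d [F [hF Fp FU]]] := hU p Up.
have [e [G [hG Gp GW]]] := hW p Wp.
exists (d + e)%N, (fun x => F x * G x); split; first exact: formM.
  exact: mulf_neq0.
move=> x Vx; rewrite mulf_eq0 negb_or => /andP[Fx Gx].
by split; [exact: FU | exact: GW].
Qed.

Lemma form_open n d (V : set 'rV[K]_n) F : is_form d F ->
  locally_open V [set x | V x /\ F x != 0].
Proof.
by move=> hF; split=> [x []//|p [Vp Fp]]; exists d, F; split.
Qed.

Lemma irreducible_form n (V : set 'rV[K]_n) :
  nonzero_set V -> irreducible V -> form_irreducible V.
Proof.
move=> nV [_ hV] d F e G [P hP FE] [Q hQ GE] [x Vx Fx] [y Vy Gy].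
pose Z (p : {mpoly K[n]}) := [set x : 'rV[K]_n | x != 0 /\
  forall q, [set p] q -> q.@[x 0] = 0].
have Zc d' (p : {mpoly K[n]}) : p \is d'.-homog -> proj_closed (Z p).
  by move=> hp; exists [set p] => // q ->; exists d'.
apply: contrapT => nex.
have VPQ : V `<=` Z P `|` Z Q.
  move=> z Vz; have nz := nV z Vz.
  have [Fz|Fz] := eqVneq (F z) 0; first by left; split=> // q ->; rewrite -FE.
  right; split=> // q ->; rewrite -GE; apply/eqP/negbNE/negP => Gz.
  by apply: nex; exists z.
case: (hV _ _ (Zc _ _ hP) (Zc _ _ hQ) VPQ) => sub.
  by have [_ /(_ P erefl)] := sub x Vx; rewrite -FE => /eqP; rewrite (negPf Fx).
by have [_ /(_ Q erefl)] := sub y Vy; rewrite -GE => /eqP; rewrite (negPf Gy).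
Qed.

Lemma irreducible_openI n (V U W : set 'rV[K]_n) :
  form_irreducible V -> locally_open V U -> locally_open V W ->
  (exists x, U x) -> (exists x, W x) -> exists2 x, U x & W x.
Proof.
move=> irrV [UV hU] [WV hW] [p Up] [q Wq].
have [d [F [hF Fp FU]]] := hU p Up.
have [e [G [hG Gq GW]]] := hW q Wq.
have [|| x [Vx Fx Gx]] := irrV _ _ _ _ hF hG; first by exists p; auto.
  by exists q; auto.
by exists x; auto.
Qed.

Lemma irreducible_dense n (V U : set 'rV[K]_n) :
  nonzero_set V -> form_irreducible V -> locally_open V U ->
  (exists x, U x) -> dense_open V U.
Proof.
move=> nV irrV oU Une; split; first exact/open_inP.
move=> W /(open_inP _ nV) oW Wne.
by have [x Ux Wx] := irreducible_openI irrV oU oW Une Wne; exists x.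
Qed.

Lemma form_identity n d (V U : set 'rV[K]_n) F :
  form_irreducible V -> locally_open V U -> (exists x, U x) ->
  is_form d F -> (forall x, U x -> F x = 0) -> forall x, V x -> F x = 0.
Proof.
move=> irrV oU Une hF vanish x Vx; apply/eqP/negbNE/negP => Fx.
have [|y Uy [_]] := irreducible_openI irrV oU (form_open V hF) Une.
  by exists x.
by rewrite vanish ?eqxx.
Qed.

Lemma dense_openP n (V U : set 'rV[K]_n) : nonzero_set V -> dense_open V U ->
  locally_open V U /\ forall W, locally_open V W -> (exists x, W x) ->
    exists2 x, U x & W x.
Proof.
move=> nV [/(open_inP _ nV) oU dU]; split=> // W /(open_inP _ nV) oW Wne.
by have [x [Ux Wx]] := dU W oW Wne; exists x.
Qed.

Lemma locally_open_cone n (V U : set 'rV[K]_n) :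
  cone V -> locally_open V U -> cone U.
Proof.
move=> cV [UV hU] x y xy Ux; have [d [F [hF Fp FU]]] := hU x Ux.
by apply: FU; [exact: cV xy (UV x Ux) | exact: same_form hF xy Fp].
Qed.

Lemma proj_closed_cone n (V : set 'rV[K]_n) : proj_closed V -> cone V.
Proof.
case=> T hT -> x y xy [x0 Tx]; split; first exact: same_neq0 xy x0.
move=> p Tp; have [d hd] := hT p Tp; case: xy => k k0 ->.
have hf : is_form d (fun x : 'rV[K]_n => p.@[x 0]) by exists p.
by rewrite (form_scale k x hf) Tx // mulr0.
Qed.

Lemma proj_closed_nonzero n (V : set 'rV[K]_n) : proj_closed V -> nonzero_set V.
Proof. by case=> T _ -> x []. Qed.

End Morphisms.

(** * Segre products and their projections *)

Section Segre.
Variable K : fieldType.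

Lemma segreE n m (x : 'rV[K]_n) (y : 'rV[K]_m) i j :
  segre x y 0 (mxvec_index i j) = x 0 i * y 0 j.
Proof. by rewrite mxvecE mxE big_ord1 mxE. Qed.

Lemma segre_neq0 n m (x : 'rV[K]_n) (y : 'rV[K]_m) :
  (segre x y != 0) = (x != 0) && (y != 0).
Proof.
apply/idP/andP => [/row_neq0P[k]|[/row_neq0P[i xi] /row_neq0P[j yj]]].
  case/mxvec_indexP: k => i j; rewrite segreE mulf_eq0 negb_or.
  by case/andP=> /row_neq0 -> /row_neq0 ->.
by apply: (@row_neq0 _ _ _ (mxvec_index i j)); rewrite segreE mulf_neq0.
Qed.

Lemma segreZ n m a b (x : 'rV[K]_n) (y : 'rV[K]_m) :
  segre (a *: x) (b *: y) = (a * b) *: segre x y.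
Proof.
apply/rowP => k; case/mxvec_indexP: k => i j.
by rewrite mxE !segreE !mxE; ring.
Qed.

Lemma same_segre n m (x x' : 'rV[K]_n) (y y' : 'rV[K]_m) :
  same_point x x' -> same_point y y' -> same_point (segre x y) (segre x' y').
Proof.
by case=> a a0 -> [b b0 ->]; rewrite segreZ; apply/same_scale/mulf_neq0.
Qed.

Lemma segre_form n m p d e (g : 'rV[K]_p -> 'rV[K]_n) (k : 'rV[K]_p -> 'rV[K]_m) :
  form_map d g -> form_map e k -> form_map (d + e) (fun z => segre (g z) (k z)).
Proof.
move=> hg hk j; case/mxvec_indexP: j => i j.
by apply: form_ext (formM (hg i) (hk j)) _ => z; rewrite segreE.
Qed.

Lemma segre_formr n m (x : 'rV[K]_n) : form_map 1 (fun y : 'rV[K]_m => segre x y).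
Proof.
move=> k; case/mxvec_indexP: k => i j.
by apply: form_ext (formZ (x 0 i) (form_coord K j)) _ => y; rewrite segreE.
Qed.

Lemma segre_forml n m (y : 'rV[K]_m) : form_map 1 (fun x : 'rV[K]_n => segre x y).
Proof.
move=> k; case/mxvec_indexP: k => i j.
apply: form_ext (formZ (y 0 j) (form_coord K i)) _ => x.
by rewrite segreE mulrC.
Qed.

(* The matrix of a pure tensor has rank one, so each nonzero column (resp. row)
   represents the first (resp. second) factor. *)
Definition fst_point n m (z : 'rV[K]_(n * m)) : 'rV[K]_n :=
  if [pick j | col j (vec_mx z) != 0] is Some j then (col j (vec_mx z))^T else 0.

Definition snd_point n m (z : 'rV[K]_(n * m)) : 'rV[K]_m :=
  if [pick i | row i (vec_mx z) != 0] is Some i then row i (vec_mx z) else 0.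

Definition column_map n m j (z : 'rV[K]_(n * m)) : 'rV[K]_n :=
  \row_i z 0 (mxvec_index i j).

Definition row_map n m i (z : 'rV[K]_(n * m)) : 'rV[K]_m :=
  \row_j z 0 (mxvec_index i j).

Lemma column_map_segre n m j (x : 'rV[K]_n) (y : 'rV[K]_m) :
  column_map j (segre x y) = y 0 j *: x.
Proof. by apply/rowP => i; rewrite !mxE segreE mulrC. Qed.

Lemma row_map_segre n m i (x : 'rV[K]_n) (y : 'rV[K]_m) :
  row_map i (segre x y) = x 0 i *: y.
Proof. by apply/rowP => j; rewrite !mxE segreE. Qed.

Lemma column_map_form n m j : form_map 1 (@column_map n m j).
Proof. by move=> i; apply: form_ext (form_coord K _) _ => z; rewrite mxE. Qed.

Lemma row_map_form n m i : form_map 1 (@row_map n m i).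
Proof. by move=> j; apply: form_ext (form_coord K _) _ => z; rewrite mxE. Qed.

Lemma fst_pointP n m (x : 'rV[K]_n) (y : 'rV[K]_m) :
  x != 0 -> y != 0 -> same_point x (fst_point (segre x y)).
Proof.
move=> x0 y0; have colE j : (col j (vec_mx (segre x y)))^T = y 0 j *: x.
  by rewrite -column_map_segre; apply/rowP => i; rewrite !mxE.
rewrite /fst_point; case: pickP => [j|none].
  rewrite -trmx_eq0 colE scaler_eq0 negb_or => /andP[yj _].
  exact: same_scale.
have [j yj] := row_neq0P y0; have := none j.
by rewrite -trmx_eq0 colE scaler_eq0 (negPf yj) (negPf x0).
Qed.

Lemma snd_pointP n m (x : 'rV[K]_n) (y : 'rV[K]_m) :
  x != 0 -> y != 0 -> same_point y (snd_point (segre x y)).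
Proof.
move=> x0 y0; have rowE i : row i (vec_mx (segre x y)) = x 0 i *: y.
  by rewrite -row_map_segre; apply/rowP => j; rewrite !mxE.
rewrite /snd_point; case: pickP => [i|none].
  by rewrite rowE scaler_eq0 negb_or => /andP[xi _]; exact: same_scale.
have [i xi] := row_neq0P x0; have := none i.
by rewrite rowE scaler_eq0 (negPf xi) (negPf y0).
Qed.

Lemma prod_nonzero n m (V : set 'rV[K]_n) (W : set 'rV[K]_m) :
  nonzero_set V -> nonzero_set W -> nonzero_set (prod_variety V W).
Proof. by move=> nV nW z [x [y [Vx Wy ->]]]; rewrite segre_neq0 nV ?nW. Qed.

Lemma fst_morphism n m (V : set 'rV[K]_n) (W : set 'rV[K]_m) :
  nonzero_set V -> nonzero_set W -> cone V ->
  morphism (prod_variety V W) V (@fst_point n m).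
Proof.
move=> nV nW cV; apply/morphismP.
have fstE x y : V x -> W y -> same_point x (fst_point (segre x y)).
  by move=> /nV x0 /nW y0; exact: fst_pointP.
split=> z [x [y [Vx Wy ->]]]; first exact: cV (fstE x y Vx Wy) Vx.
have [j yj] := row_neq0P (nW y Wy).
exists 1%N, (column_map j); split; first exact: column_map_form.
  by rewrite column_map_segre scaler_eq0 negb_or yj nV.
move=> _ [x' [y' [Vx' Wy' ->]]].
rewrite column_map_segre scaler_eq0 negb_or => /andP[yj' _].
exact: same_trans (same_sym (same_scale _ yj')) (fstE x' y' Vx' Wy').
Qed.

Lemma snd_morphism n m (V : set 'rV[K]_n) (W : set 'rV[K]_m) :
  nonzero_set V -> nonzero_set W -> cone W ->
  morphism (prod_variety V W) W (@snd_point n m).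
Proof.
move=> nV nW cW; apply/morphismP.
have sndE x y : V x -> W y -> same_point y (snd_point (segre x y)).
  by move=> /nV x0 /nW y0; exact: snd_pointP.
split=> z [x [y [Vx Wy ->]]]; first exact: cW (sndE x y Vx Wy) Wy.
have [i xi] := row_neq0P (nV x Vx).
exists 1%N, (row_map i); split; first exact: row_map_form.
  by rewrite row_map_segre scaler_eq0 negb_or xi nW.
move=> _ [x' [y' [Vx' Wy' ->]]].
rewrite row_map_segre scaler_eq0 negb_or => /andP[xi' _].
exact: same_trans (same_sym (same_scale _ xi')) (sndE x' y' Vx' Wy').
Qed.

Lemma pair_morphism n m p (V : set 'rV[K]_p) (W : set 'rV[K]_n)
    (Y : set 'rV[K]_m) phi psi :
  morphism V W phi -> morphism V Y psi ->
  morphism V (prod_variety W Y) (fun x => segre (phi x) (psi x)).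
Proof.
move=> /morphismP[VW hphi] /morphismP[VY hpsi]; apply/morphismP.
split=> [x Vx|x Vx]; first by exists (phi x), (psi x); split; auto.
have [d [g [hg gx gphi]]] := hphi x Vx.
have [e [k [hk kx kpsi]]] := hpsi x Vx.
exists (d + e)%N, (fun z => segre (g z) (k z)); split.
- exact: segre_form.
- by rewrite segre_neq0 gx.
- move=> z Vz; rewrite segre_neq0 => /andP[gz kz].
  by apply: same_segre; auto.
Qed.

(** The factors are treated one at a time: the slices through [x] and [x'] yield one [w] in [W] good
    for both forms, and the slice at [w] then yields [v]. *)
Lemma prod_irreducible n m (V : set 'rV[K]_n) (W : set 'rV[K]_m) :
  form_irreducible V -> form_irreducible W ->
  form_irreducible (prod_variety V W).
Proof.
move=> irrV irrW d F e G hF hG [_ [x [y [Vx Wy ->]]] Fxy].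
case=> [_ [x' [y' [Vx' Wy' ->]]] Gxy].
have [|| w [Ww Fw Gw]] := irrW _ _ _ _ (form_comp hF (segre_formr x))
    (form_comp hG (segre_formr x')); [by exists y | by exists y' |].
have [|| v [Vv Fv Gv]] := irrV _ _ _ _ (form_comp hF (segre_forml w))
    (form_comp hG (segre_forml w)); [by exists x | by exists x' |].
by exists (segre v w); split=> //; exists v, w.
Qed.

(** A form nonzero somewhere on [W] is nonzero somewhere on the dense set [U'], hence pulls back
    along [phi] to a nonempty open subset of [V]. In this way the affine plane curve inherits
    irreducibility from its smooth model. *)
Lemma birational_irreducible n m (V U : set 'rV[K]_n) (W U' : set 'rV[K]_m)
    phi psi :
  nonzero_set W -> form_irreducible V -> locally_open V U -> dense_open W U' ->
  mutually_inverse U U' phi psi -> form_irreducible W.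
Proof.
move=> nW irrV oU /(dense_openP nW)[oU' dU'] [mphi mpsi _ phipsi].
have pull d F : is_form d F -> (exists2 y, W y & F y != 0) ->
    locally_open V [set x | U x /\ F (phi x) != 0] /\
    exists x, U x /\ F (phi x) != 0.
  move=> hF [y Wy Fy]; split.
    apply: locally_open_trans oU _.
    have := preimage_open mphi (form_open U' hF); congr locally_open.
    apply/seteqP; split=> x /= [Ux]; first by case.
    by split=> //; split=> //; exact: (morphism_maps mphi).
  have [|w U'w [_ Fw]] := dU' _ (form_open W hF); first by exists y.
  exists (psi w); split; first exact: (morphism_maps mpsi).
  exact: same_form hF (phipsi w U'w) Fw.
move=> d F e G hF hG /(pull _ _ hF)[oF neF] /(pull _ _ hG)[oG neG].
have [x [Ux Fx] [_ Gx]] := irreducible_openI irrV oF oG neF neG.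
exists (phi x); split=> //.
by case: oU' => U'W _; apply/U'W/(morphism_maps mphi).
Qed.

End Segre.

(** * Saturation of polynomial vectors, cyclic covers and cube roots of unity *)

Section Polynomials.
Variable K : numClosedFieldType.

Lemma poly_nonroot (p : {poly K}) : p != 0 -> exists x, p.[x] != 0.
Proof.
move=> p0; apply: contrapT => nex.
pose rs := [seq i%:R : K | i <- iota 0 (size p)].
have /(max_poly_roots p0) : all (root p) rs.
  by apply/allP => x _; apply/negbNE/negP => px; apply: nex; exists x.
rewrite size_map size_iota ltnn map_inj_uniq ?iota_uniq; last exact: mulrIn (oner_neq0 _).
by move=> /(_ isT).
Qed.

(** Dividing by the local parameter at 0 terminates because each division lowers the degree of a
    fixed nonzero coordinate. *)
Lemma polyX_saturate N (w : 'rV[{poly K}]_N) : w != 0 ->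
  exists k w' j, w = ('X - 0%:P) ^+ k *: w' /\ (w' 0 j).[0] != 0.
Proof.
case/row_neq0P => j; have [n] := ubnP (size (w 0 j)).
elim: n => // n IH in w * => lt_n wj.
have [[i wi]|none] := pselect (exists i, (w 0 i).[0] != 0).
  by exists 0%N, w, i; rewrite expr0 scale1r.
pose w1 := map_mx (fun p => p %/ ('X - 0%:P)) w.
have wE : w = ('X - 0%:P) *: w1.
  apply/rowP => i; rewrite !mxE mulrC divpK // dvdp_XsubCl.
  by apply/negbNE/negP => wi; apply: none; exists i.
have w1j : w1 0 j != 0.
  by apply: contraNN wj => /eqP w1j; rewrite wE mxE w1j mulr0.
have [|//|k [w' [i [w1E w'i]]]] := IH w1.
  by move: lt_n; rewrite wE mxE mulrC size_Mmonic ?monicXsubC // size_XsubC addn2.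
by exists k.+1, w', i; rewrite wE w1E scalerA exprS.
Qed.

(* The span of the vectors [ws] over the field of rational functions has a
   generating family, the rows of [d^-1 *: B], regular at 0 and reproducing
   every vector of the span as a combination with regular coefficients. *)
Lemma span_saturation N (ws : seq 'rV[{poly K}]_N) :
  exists (B : 'M[{poly K}]_N) (d e : {poly K}),
  [/\ d.[0] != 0, e != 0, forall w, w \in ws -> w *m B = d *: w &
    forall a (u : 'cV[K]_N), e.[a] != 0 ->
      (forall w, w \in ws -> map_mx (horner_eval a) w *m u = 0) ->
      map_mx (horner_eval a) B *m u = 0].
Proof.
elim: ws => [|w ws [B [d [e [d0 e0 wB orthB]]]]].
  exists 0, 1, 1; split=> //; rewrite ?hornerC ?oner_eq0 //.
  by move=> a u _ _; rewrite map_mx0 mul0mx.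
have [w0|/polyX_saturate[k [w' [j [wE w'j]]]]] := eqVneq (d *: w - w *m B) 0.
  exists B, d, e; split=> // [v|a u ea orth].
    by rewrite inE => /orP[/eqP ->|/wB//]; apply/esym/eqP; rewrite -subr_eq0 w0.
  by apply: orthB ea _ => v vws; apply: orth; rewrite inE vws orbT.
pose c : 'cV[{poly K}]_N := delta_mx j 0.
have rowc (v : 'rV[{poly K}]_N) : v *m c = (v 0 j)%:M.
  by rewrite -colE; apply/rowP => i; rewrite ord1 !mxE mulr1n.
(* Call [d *: v - v *m B] the defect of [v]. The new matrix sends [v] to [w' 0 j *: (v *m B)] plus
   the multiple of [w'] given by coordinate [j] of the defect. The defect is 0 for the older vectors
   and a multiple of [w'] for [w], so all are reproduced with denominator [d * w' 0 j], still
   nonzero at 0. The factor X in the new [e] allows [w'] to be recovered from its multiple by a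
   power of X. *)
exists (w' 0 j *: B + (d *: c - B *m c) *m w'), (d * w' 0 j), (e * ('X - 0%:P)).
have combE (v : 'rV[{poly K}]_N) :
    v *m (w' 0 j *: B + (d *: c - B *m c) *m w') =
    w' 0 j *: (v *m B) + (d *: v - v *m B) 0 j *: w'.
  rewrite mulmxDr -scalemxAr mulmxA mulmxBr mulmxA -scalemxAr; congr (_ + _).
  by rewrite -[RHS]mul_scalar_mx -rowc [in RHS]mulmxBl -[in RHS]scalemxAl.
split.
- by rewrite hornerM mulf_neq0.
- by rewrite mulf_neq0 // polyXsubC_eq0.
- move=> v; rewrite inE combE => /orP[/eqP ->|/wB ->].
    have dw : d *: w = ('X - 0%:P) ^+ k *: w' + w *m B by rewrite -wE subrK.
    have -> : (d * w' 0 j) *: w = w' 0 j *: (d *: w) by rewrite scalerA mulrC.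
    rewrite wE mxE dw scalerDr [in RHS]scalerA addrC.
    by congr (_ *: _ + _); rewrite mulrC.
  by rewrite subrr mxE scale0r addr0 scalerA mulrC.
- move=> a u; rewrite hornerM hornerXsubC subr0 mulf_eq0 negb_or => /andP[ea a0] orth.
  have Bu : map_mx (horner_eval a) B *m u = 0.
    by apply: orthB ea _ => v vws; apply: orth; rewrite inE vws orbT.
  have w'u : map_mx (horner_eval a) w' *m u = 0.
    have : map_mx (horner_eval a) (d *: w - w *m B) *m u = 0.
      rewrite map_mxB map_mxM map_mxZ mulmxBl -mulmxA Bu mulmx0 -scalemxAl.
      by rewrite orth ?mem_head // scaler0 subr0.
    rewrite wE map_mxZ -scalemxAl => /eqP; rewrite scaler_eq0 => /orP[|/eqP//].
    by rewrite rmorphXn /= horner_evalE hornerXsubC subr0 expf_eq0 (negPf a0) andbF.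
  rewrite map_mxD map_mxM map_mxZ mulmxDl -scalemxAl Bu -mulmxA w'u.
  by rewrite mulmx0 scaler0 addr0.
Qed.

(** The outer variable of [P] is v, so that reduction modulo v^N - q is division by a monic
    polynomial over K[x]. *)
Definition bivariate (H : K -> K -> K) : Prop :=
  exists P : {poly {poly K}}, forall v x, H v x = P.[v%:P].[x].

Lemma bivariate_ext H H' : bivariate H -> H' =2 H -> bivariate H'.
Proof. by case=> P HE H'E; exists P => v x; rewrite H'E. Qed.

Lemma bivariate_const c : bivariate (fun _ _ => c).
Proof. by exists c%:P%:P => v x; rewrite !hornerC. Qed.

Lemma bivariate_fst : bivariate (fun v _ => v).
Proof. by exists 'X => v x; rewrite hornerX hornerC. Qed.

Lemma bivariate_snd : bivariate (fun _ x => x).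
Proof. by exists 'X%:P => v x; rewrite hornerC hornerX. Qed.

Lemma bivariateD H H' :
  bivariate H -> bivariate H' -> bivariate (fun v x => H v x + H' v x).
Proof.
by case=> P HE [Q H'E]; exists (P + Q) => v x; rewrite !hornerD HE H'E.
Qed.

Lemma bivariateM H H' :
  bivariate H -> bivariate H' -> bivariate (fun v x => H v x * H' v x).
Proof.
by case=> P HE [Q H'E]; exists (P * Q) => v x; rewrite !hornerM HE H'E.
Qed.

Lemma bivariateX H k : bivariate H -> bivariate (fun v x => H v x ^+ k).
Proof.
by case=> P HE; exists (P ^+ k) => v x; rewrite !horner_exp HE.
Qed.

Lemma bivariate_form n d (F : 'rV[K]_n -> K) (a : K -> K -> 'rV[K]_n) :
  is_form d F -> (forall i, bivariate (fun v x => a v x 0 i)) ->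
  bivariate (fun v x => F (a v x)).
Proof.
case=> P _ FE ha.
apply: (@bivariate_ext (fun v x => \sum_(m <- msupp P) P@_m *
  \prod_(i < n) a v x 0 i ^+ m i)); last by move=> v x; rewrite FE mevalE.
elim: (msupp P) => [|m s IH].
  by apply: bivariate_ext (bivariate_const 0) _ => v x; rewrite big_nil.
suff hm : bivariate (fun v x => P@_m * \prod_(i < n) a v x 0 i ^+ m i).
  by apply: bivariate_ext (bivariateD hm IH) _ => v x; rewrite big_cons.
apply: bivariateM (bivariate_const _) _.
elim: (index_enum _) => [|i r IHr].
  by apply: bivariate_ext (bivariate_const 1) _ => v x; rewrite big_nil.
apply: bivariate_ext (bivariateM (bivariateX (m i) (ha i)) IHr) _ => v x.
by rewrite big_cons.
Qed.

(** Modulo the monic polynomial v^N - q, the ring K[x][v] is free over K[x] on 1, ..., v^(N-1); the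
    [P k] are the coefficients of the remainder. *)
Lemma cyclic_cover_decomposition N (q : {poly K}) H : (0 < N)%N ->
  bivariate H -> exists P : nat -> {poly K}, forall v x, v ^+ N = q.[x] ->
    H v x = \sum_(k < N) v ^+ k * (P k).[x].
Proof.
move=> N0 [P HE]; pose D : {poly {poly K}} := 'X^N - q%:P.
have mD : D \is monic by rewrite monicXnsubC.
have szR : (size (Pdiv.Ring.rmodp P D) <= N)%N.
  have := Pdiv.Ring.ltn_rmodpN0 P (monic_neq0 mD).
  by rewrite size_XnsubC // ltnS.
exists (fun k => (Pdiv.Ring.rmodp P D)`_k) => v x vN.
have DE : D.[v%:P].[x] = 0.
  rewrite /D hornerD hornerN hornerXn hornerC hornerD hornerN -rmorphXn /=.
  by rewrite hornerC vN subrr.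
rewrite HE {1}(Pdiv.RingMonic.rdivp_eq mD P) !hornerD !hornerM DE mulr0 add0r.
rewrite (horner_coef_wide _ szR) horner_sum; apply: eq_bigr => k _.
by rewrite hornerM -rmorphXn /= hornerC mulrC.
Qed.

Lemma cube_root_unity : exists2 w : K, w ^+ 2 + w + 1 = 0 & w ^+ 3 = 1.
Proof.
pose s := sqrtC (- 3%:R : K); pose w := (s - 1) / 2%:R.
have w2 : w ^+ 2 + w + 1 = 0.
  have s2 : s ^+ 2 = - 3%:R by rewrite sqrtCK.
  have -> : w ^+ 2 + w + 1 = (s ^+ 2 + 3%:R) / 4%:R by rewrite /w; field.
  by rewrite s2 addNr mul0r.
exists w => //; have -> : w ^+ 3 = (w - 1) * (w ^+ 2 + w + 1) + 1 by ring.
by rewrite w2 mulr0 add0r.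
Qed.

(** This is Fourier inversion of order three, with multiples of w^2 + w + 1 added to make it a ring
    identity. It separates the components v^k P_k of a function from its values on the three sheets
    of a cyclic cubic cover. *)
Lemma cyclic_system (w a0 a1 a2 : K) : w ^+ 2 + w + 1 = 0 ->
  (forall i : nat, (i < 3)%N -> a0 + w ^+ i * a1 + w ^+ i ^+ 2 * a2 = 0) ->
  [/\ a0 = 0, a1 = 0 & a2 = 0].
Proof.
move=> w2 hw.
have e0 := hw 0%N isT; have e1 := hw 1%N isT; have e2 := hw 2 isT.
have a00 : a0 = 0.
  have : 3%:R * a0 = (a0 + w ^+ 0 * a1 + w ^+ 0 ^+ 2 * a2) +
      (a0 + w ^+ 1 * a1 + w ^+ 1 ^+ 2 * a2) +
      (a0 + w ^+ 2 * a1 + w ^+ 2 ^+ 2 * a2) -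
      (w ^+ 2 + w + 1) * (a1 + a2 * (w ^+ 2 - w + 1)) by ring.
  rewrite e0 e1 e2 w2 mul0r !addr0 subr0 => /eqP.
  by rewrite mulf_eq0 pnatr_eq0 /= => /eqP.
have e12 : a2 = - a1.
  move: e0; rewrite a00 expr0 expr1n !mul1r add0r => /eqP.
  by rewrite addr_eq0 => /eqP ->; rewrite opprK.
have : 3%:R * a1 = (a0 + w ^+ 1 * a1 + w ^+ 1 ^+ 2 * a2) * (w ^+ 2 - w)
   + (w ^+ 2 + w + 1) * (w ^+ 2 - 3 * w + 3) * a1.
  by rewrite a00 e12; ring.
rewrite e1 w2 !mul0r addr0 => /eqP; rewrite mulf_eq0 pnatr_eq0 /= => /eqP a10.
by rewrite e12 a10 oppr0.
Qed.

End Polynomials.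

(** * The cubics y^2 = x^3 + b and their irreducibility *)

Section EllipticCurve.
Variable K : numClosedFieldType.

Definition point3 (x y w : K) : 'rV[K]_3 := \row_i [:: x; y; w]`_i.

Lemma point3E (z : 'rV[K]_3) :
  z = point3 (z 0 ord0) (z 0 (inord 1)) (z 0 (inord 2)).
Proof.
apply/rowP => -[[|[|[|i]]] hi]; rewrite mxE //=; congr (z 0 _);
  by apply/val_inj; rewrite /= ?inordK.
Qed.

Lemma point3Z k x y w : k *: point3 x y w = point3 (k * x) (k * y) (k * w).
Proof. by apply/rowP => -[[|[|[|i]]] hi]; rewrite !mxE. Qed.

Lemma point3_eq0 x y w : (point3 x y w == 0) = [&& x == 0, y == 0 & w == 0].
Proof.
apply/eqP/and3P => [/rowP h|[/eqP -> /eqP -> /eqP ->]].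
  split; apply/eqP; first by have := h ord0; rewrite !mxE.
    by have := h (Ordinal (isT : 1 < 3)%N); rewrite !mxE.
  by have := h (Ordinal (isT : 2 < 3)%N); rewrite !mxE.
by apply/rowP => -[[|[|[|i]]] hi]; rewrite !mxE.
Qed.

Lemma weierstrassP a b x y w : weierstrass_cubic a b (point3 x y w) <->
  point3 x y w != 0 /\
  y ^+ 2 * w = x ^+ 3 + a * x * w ^+ 2 + b * w ^+ 3.
Proof.
split=> [[x' [y' [w' [zE z0 eq]]]]|[z0 eq]]; last by exists x, y, w.
split=> //; move/rowP: zE => h.
have -> : x = x' by have := h ord0; rewrite !mxE.
have -> : y = y' by have := h (Ordinal (isT : 1 < 3)%N); rewrite !mxE.
by have -> : w = w' by have := h (Ordinal (isT : 2 < 3)%N); rewrite !mxE.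
Qed.

Lemma weierstrass_nonzero a b : nonzero_set (@weierstrass_cubic K a b).
Proof. by move=> _ [x [y [w [->]]]]. Qed.

Lemma weierstrass_cone a b : cone (@weierstrass_cubic K a b).
Proof.
move=> z _ [k k0 ->]; rewrite (point3E z) point3Z => /weierstrassP[z0 eq].
apply/weierstrassP; split; first by rewrite -point3Z scaler_eq0 negb_or k0.
transitivity (k ^+ 3 * (z 0 (inord 1) ^+ 2 * z 0 (inord 2))); first by ring.
by rewrite eq; ring.
Qed.

Lemma bivariate_point3 f g h : bivariate f -> bivariate g -> bivariate h ->
  forall i, bivariate (fun v x : K => point3 (f v x) (g v x) (h v x) 0 i).
Proof.
move=> hf hg hh [[|[|[|i]]] hi] //; by
  [apply: bivariate_ext hf _ => v x; rewrite mxE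
  |apply: bivariate_ext hg _ => v x; rewrite mxE
  |apply: bivariate_ext hh _ => v x; rewrite mxE].
Qed.

(* The point at infinity is a limit of affine points: in the chart [y = 1] the
   cubic is the cyclic triple cover [x^3 = w - b w^3], and the average of a form
   over its sheets is a polynomial in [w]. *)
Lemma weierstrass_affine_dense b d (F : 'rV[K]_3 -> K) :
  is_form d F -> (exists2 z, weierstrass_cubic 0 b z & F z != 0) ->
  exists x y, y ^+ 2 = x ^+ 3 + b /\ F (point3 x y 1) != 0.
Proof.
move=> hF [z]; rewrite (point3E z); move: (z 0 _) (z 0 _) (z 0 _) => w y x.
move=> /weierstrassP[z0 eq] Fz; apply: contrapT => nex.
have vanish x1 y1 w1 : w1 != 0 -> y1 ^+ 2 * w1 = x1 ^+ 3 + b * w1 ^+ 3 ->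
    F (point3 x1 y1 w1) = 0.
  move=> w10 eq1; apply/eqP/negbNE/negP => F1; apply: nex.
  exists (x1 / w1), (y1 / w1); split.
    have -> : (y1 / w1) ^+ 2 = (y1 ^+ 2 * w1) / w1 ^+ 3 by field.
    by rewrite eq1; field.
  apply: same_form hF _ F1; exists w1^-1; first by rewrite invr_eq0.
  by rewrite point3Z !(mulrC w1^-1) divff.
have [w0|w0] := eqVneq w 0; last first.
  by case/eqP: Fz; apply: vanish => //; rewrite eq; ring.
have x0 : x = 0.
  move: eq; rewrite w0 !expr0n /= !mulr0 !addr0 => /esym/eqP.
  by rewrite expf_eq0 /= => /eqP.
have F010 : F (point3 0 1 0) != 0.
  have y0 : y != 0 by move: z0; rewrite x0 w0 point3_eq0 !eqxx /= andbT.
  apply: same_form hF _ Fz; exists y^-1; first by rewrite invr_eq0.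
  by rewrite point3Z x0 w0 !mulr0 mulVf.
have biv : bivariate (fun x w => F (point3 x 1 w)).
  apply: bivariate_form hF (bivariate_point3 _ _ _).
  - exact: bivariate_fst. - exact: bivariate_const. - exact: bivariate_snd.
have [P PE] := cyclic_cover_decomposition ('X - b *: 'X^3) (isT : 0 < 3)%N biv.
have [om om2 om3] := cube_root_unity K.
have P0 t : t != 0 -> (P 0%N).[t] = 0.
  move=> t0; have [u uE] : exists u, u ^+ 3 = t - b * t ^+ 3.
    by exists (3.-root (t - b * t ^+ 3)); rewrite rootCK.
  have omu i : (om ^+ i * u) ^+ 3 = t - b * t ^+ 3.
    by rewrite exprMn exprAC om3 expr1n mul1r.
  suff [] : [/\ (P 0%N).[t] = 0, u * (P 1%N).[t] = 0 & u ^+ 2 * (P 2%N).[t] = 0] by [].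
  apply: cyclic_system om2 _ => i _.
  have := vanish (om ^+ i * u) 1 t t0; rewrite omu subrK expr1n mul1r.
  move=> /(_ erefl); rewrite PE; last by rewrite omu !hornerE.
  by rewrite !big_ord_recl big_ord0 /= /bump /= => <-; ring.
have P0p : P 0%N = 0.
  apply/eqP/negbNE/negP => P00.
  have [|t] := @poly_nonroot K (P 0%N * 'X); first by rewrite mulf_neq0 ?polyX_eq0.
  rewrite hornerM hornerX mulf_eq0 negb_or => /andP[Pt t0].
  by rewrite P0 ?eqxx in Pt.
move: F010; rewrite PE; last by rewrite !hornerE !expr0n /= mulr0 ?oppr0 ?addr0 ?subrr.
by rewrite !big_ord_recl big_ord0 P0p /= horner0 !expr0n /= !mul0r mulr0 !addr0 eqxx.
Qed.

(** The norm of a form to the x-line, the product of its values at (x, y) and (x, -y), equals P0^2 -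
    q P1^2. It is a nonzero polynomial because q has odd degree, and over a common nonroot of two
    norms both forms are nonzero. *)
Lemma weierstrass_irreducible b : form_irreducible (@weierstrass_cubic K 0 b).
Proof.
pose q : {poly K} := 'X^3 + b%:P.
have szq : size q = 4 by rewrite size_XnaddC.
have normal d F : is_form d F -> (exists2 z, weierstrass_cubic 0 b z & F z != 0) ->
    exists2 N : {poly K}, N != 0 & forall x y, y ^+ 2 = q.[x] ->
      N.[x] = F (point3 x y 1) * F (point3 x (- y) 1).
  move=> hF /(weierstrass_affine_dense hF)[x0 [y0 [eq0 F0]]].
  have biv : bivariate (fun y x => F (point3 x y 1)).
    apply: bivariate_form hF (bivariate_point3 _ _ _).
    - exact: bivariate_snd. - exact: bivariate_fst. - exact: bivariate_const.
  have [P PE] := cyclic_cover_decomposition q (isT : 0 < 2)%N biv.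
  have FE x y : y ^+ 2 = q.[x] -> F (point3 x y 1) = (P 0%N).[x] + y * (P 1%N).[x].
    by move=> /PE ->; rewrite !big_ord_recl big_ord0 /= /bump /=; ring.
  exists (P 0%N ^+ 2 - P 1%N ^+ 2 * q); last first.
    move=> x y eq; rewrite !FE ?sqrrN // !expr2 hornerD hornerN !hornerM -eq; ring.
  apply: contraNneq F0 => /eqP; rewrite subr_eq0 => /eqP PPq.
  have P1 : P 1%N = 0.
    apply/eqP/negbNE/negP => P10.
    (* Here [(size p).-1] is the degree: even for the square on the left, odd on the right, where q
       contributes 3. *)
    have := congr1 (fun p : {poly K} => odd (size p).-1) PPq.
    rewrite size_exp size_mul ?expf_neq0 // -?size_poly_gt0 ?szq //.
    have := size_exp (P 1%N) 2.
    have : (0 < size (P 1%N ^+ 2))%N by rewrite size_poly_gt0 expf_neq0.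
    case: (size (P 1%N ^+ 2)) => // s _ /= ->; rewrite !addnS /= addn0 oddM andbF /=.
    by rewrite oddM andbF.
  have P0 : P 0%N = 0.
    by move/eqP: PPq; rewrite P1 expr0n mul0r expf_eq0 /= => /eqP.
  rewrite FE; first by rewrite P0 P1 !horner0 mulr0 addr0.
  by rewrite eq0 !hornerE.
move=> d F e G hF hG /(normal _ _ hF)[M M0 ME] /(normal _ _ hG)[N N0 NE].
have [x] := poly_nonroot (mulf_neq0 M0 N0).
have sx : sqrtC q.[x] ^+ 2 = q.[x] by rewrite sqrtCK.
rewrite hornerM (ME x _ sx) (NE x _ sx) !mulf_eq0 !negb_or.
case/andP=> /andP[Fx _] /andP[Gx _]; exists (point3 x (sqrtC q.[x]) 1).
split=> //; apply/weierstrassP; split; first by rewrite point3_eq0 oner_eq0 !andbF.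
by rewrite sx /q hornerD hornerXn hornerC; ring.
Qed.

End EllipticCurve.

(** * Splitting forms on a Segre product, and functions on the curve over the u-line *)

Section Density.
Variable K : numClosedFieldType.

Definition pair2 (a b : K) : 'rV[K]_2 := row_mx a%:M b%:M.

Lemma pair2_0 a b : pair2 a b 0 0 = a.
Proof.
rewrite mxE; case: splitP => j; rewrite ord1 => //= _.
by rewrite mxE eqxx mulr1n.
Qed.

Lemma pair2_1 a b : pair2 a b 0 1 = b.
Proof.
rewrite mxE; case: splitP => j; rewrite ord1 => //= _.
by rewrite mxE eqxx mulr1n.
Qed.

Lemma ord2_cases (i : 'I_2) : i = 0 \/ i = 1.
Proof. by case: i => -[|[|i]] hi //; [left|right]; apply: val_inj. Qed.

Lemma pair2_eta (s : 'rV[K]_2) : s = pair2 (s 0 0) (s 0 1).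
Proof.
by apply/rowP => i; have [->|->] := ord2_cases i; rewrite ?pair2_0 ?pair2_1.
Qed.

Lemma pair2Z k a b : k *: pair2 a b = pair2 (k * a) (k * b).
Proof. by rewrite [LHS]pair2_eta; congr pair2; rewrite [LHS]mxE ?pair2_0 ?pair2_1. Qed.

Definition homogenize (D : nat) (p : {poly K}) (a b : K) : K :=
  \sum_(k < D.+1) p`_k * b ^+ k * a ^+ (D - k).

Lemma homogenizeE D (p : {poly K}) (a b : K) : (size p <= D.+1)%N -> a != 0 ->
  homogenize D p a b = a ^+ D * p.[b / a].
Proof.
move=> szp a0; rewrite (horner_coef_wide _ szp) mulr_sumr; apply: eq_bigr => k _.
have -> : a ^+ D = a ^+ (D - k) * a ^+ k by rewrite -exprD subnK // leq_ord.
by rewrite expr_div_n; field; rewrite expf_neq0.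
Qed.

Lemma homogenize0 D p a : homogenize D p a 0 = a ^+ D * p.[0].
Proof.
rewrite /homogenize big_ord_recl big1 ?addr0 => [|i _].
  by rewrite expr0 mulr1 subn0 horner_coef0 mulrC.
by rewrite lift0 expr0n /= mulr0 mul0r.
Qed.

Lemma form_homogenize n l D p (F G : 'rV[K]_n -> K) :
  is_form l F -> is_form l G ->
  is_form (l * D) (fun x => homogenize D p (F x) (G x)).
Proof.
move=> hF hG; apply: form_sum => k _.
have -> : (l * D = 0 + l * k + l * (D - k))%N.
  by rewrite add0n -mulnDr subnKC // leq_ord.
exact: formM (formM (form_const _ _) (formX k hG)) (formX _ hF).
Qed.

Definition eval_mx (t : K) m n (W : 'M[{poly K}]_(m, n)) : 'M[K]_(m, n) :=
  map_mx (horner_eval t) W.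

(** A monomial in the products x_i y_j is a monomial in x times a monomial in y. The index [a] runs
    through the support of the polynomial, and [Y] absorbs the coefficients. *)
Lemma form_segre_split n m d (Q : 'rV[K]_(n * m) -> K) : is_form d Q ->
  exists N (A : 'rV[K]_n -> 'rV[K]_N) (Y : 'rV[K]_m -> 'rV[K]_N),
  [/\ form_map d A, form_map d Y &
    forall x y, Q (segre x y) = \sum_a Y y 0 a * A x 0 a].
Proof.
case=> P hP QE; pose s := in_tuple (msupp P); pose N := size (msupp P).
pose pr (k : 'I_(n * m)) := enum_val (cast_ord (esym (mxvec_cast n m)) k).
have segre_pr x y k : segre x y 0 k = x 0 (pr k).1 * y 0 (pr k).2.
  case/mxvec_indexP: k => i j; rewrite segreE /pr /mxvec_index.
  by rewrite cast_ordK enum_rankK.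
have dsum (a : 'I_N) : (d = \sum_(k <- index_enum 'I_(n * m)) 1 * tnth s a k)%N.
  have sa : tnth s a \in msupp P by exact: mem_tnth.
  have <- : mdeg (tnth s a) = d := dhomog_mf hP sa.
  by rewrite mdegE; apply: eq_bigr => k _; rewrite mul1n.
exists N, (fun x => \row_(a < N) \prod_(k < n * m) x 0 (pr k).1 ^+ tnth s a k).
exists (fun y => \row_(a < N) (P@_(tnth s a) *
  \prod_(k < n * m) y 0 (pr k).2 ^+ tnth s a k)); split.
- move=> a; rewrite {1}(dsum a); apply: form_ext (form_prod _ _) _; last first.
    by move=> x; rewrite mxE.
  by move=> k; exact/formX/form_coord.
- move=> a; rewrite {1}(dsum a); apply: form_ext (formZ _ (form_prod _ _)) _; last first.
    by move=> x; rewrite mxE.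
  by move=> k; exact/formX/form_coord.
- move=> x y; rewrite QE mevalE big_tnth; apply: eq_bigr => a _; rewrite !mxE.
  rewrite -mulrA -big_split /=; congr (_ * _); apply: eq_bigr => k _.
  by rewrite segre_pr exprMn mulrC.
Qed.

Definition on_curve (f0 : {poly K}) (v x : K) : Prop := v ^+ 3 = x * f0.[x ^+ 2].

(** Functions on the affine curve are spanned over K[u], u = x^2, by the six monomials v^k x^b with
    k < 3 and b < 2; the boolean argument of [W] is b. *)
Lemma curve_decomposition f0 N (y : K -> K -> 'rV[K]_N) :
  (forall a, bivariate (fun v x => y v x 0 a)) ->
  exists W : nat -> bool -> 'rV[{poly K}]_N, forall v x, on_curve f0 v x ->
    y v x = \sum_(k < 3) v ^+ k *:
      (eval_mx (x ^+ 2) (W k false) + x *: eval_mx (x ^+ 2) (W k true)).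
Proof.
move=> hy; pose q := 'X * (f0 \Po 'X^2).
have /fin_all_exists[P PE] a := cyclic_cover_decomposition q (isT : 0 < 3)%N (hy a).
exists (fun k b => \row_a if b then odd_poly (P a k) else even_poly (P a k)).
move=> v x vx; apply/rowP => a; rewrite PE; last first.
  by rewrite hornerM hornerX horner_comp hornerXn.
rewrite summxE; apply: eq_bigr => k _; rewrite !mxE; congr (_ * _).
rewrite -[in LHS](poly_even_odd (P a k)) hornerD hornerM hornerX.
by rewrite !horner_comp hornerXn /horner_eval [x * _]mulrC.
Qed.

(** For nonzero v and x there are six points over u, namely (om^i v, x) and (- om^i v, - x), and the
    six monomials v^k x^b form an invertible system on them: a Fourier inversion of order three for
    each sign, then one of order two. The sign of v follows that of x because v^3 = x f0(x^2) is odd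
    in (v, x). *)
Lemma curve_independence f0 N (y : K -> K -> 'rV[K]_N)
    (W : nat -> bool -> 'rV[{poly K}]_N) (u v x : K) (A : 'cV[K]_N) :
  (forall v x, on_curve f0 v x -> y v x = \sum_(k < 3) v ^+ k *:
      (eval_mx (x ^+ 2) (W k false) + x *: eval_mx (x ^+ 2) (W k true))) ->
  v != 0 -> x != 0 -> x ^+ 2 = u -> on_curve f0 v x ->
  (forall v' x', x' ^+ 2 = u -> on_curve f0 v' x' -> y v' x' *m A = 0) ->
  forall (k : 'I_3) b, eval_mx u (W k b) *m A = 0.
Proof.
move=> yE v0 x0 xu vx orth.
have [om om2 om3] := cube_root_unity K.
have half (v1 x1 : K) : v1 != 0 -> x1 ^+ 2 = u -> on_curve f0 v1 x1 ->
    forall k : 'I_3,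
    (eval_mx u (W k false) *m A) 0 0 + x1 * (eval_mx u (W k true) *m A) 0 0 = 0.
  move=> v10 xu1 vx1; pose c (k : nat) := (eval_mx u (W k false) *m A) 0 0 +
    x1 * (eval_mx u (W k true) *m A) 0 0.
  have [c0 c1 c2] : [/\ c 0%N = 0, v1 * c 1%N = 0 & v1 ^+ 2 * c 2 = 0].
    apply: cyclic_system om2 _ => i _.
    have omv : on_curve f0 (om ^+ i * v1) x1.
      by rewrite /on_curve exprMn exprAC om3 expr1n mul1r.
    have := congr1 (fun Z : 'M_1 => Z 0 0) (orth _ _ xu1 omv).
    rewrite (yE _ _ omv) xu1 mulmx_suml summxE !big_ord_recl big_ord0 /= /bump /=.
    rewrite -!scalemxAl !mulmxDl -!scalemxAl [RHS]mxE => <-.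
    by rewrite /c !mxE; ring.
  move=> [[|[|[|k]]] hk] //=.
    by move/eqP: c1; rewrite mulf_eq0 (negPf v10) => /eqP.
  by move/eqP: c2; rewrite mulf_eq0 expf_eq0 (negPf v10) => /eqP.
have vxN : on_curve f0 (- v) (- x).
  by rewrite /on_curve sqrrN mulNr -vx; ring.
move=> k b; apply/rowP => j; rewrite ord1 [RHS]mxE.
have hp := half v x v0 xu vx k.
have hn := half (- v) (- x) _ _ vxN k; rewrite sqrrN oppr_eq0 in hn.
have {}hn := hn v0 xu.
case: b; move: hp hn; set a := (_ *m _) 0 0; set b := (_ *m _) 0 0 => hp hn.
  have : 2%:R * x * b = (a + x * b) - (a + - x * b) by ring.
  by rewrite hp hn subrr => /eqP; rewrite !mulf_eq0 pnatr_eq0 (negPf x0) => /eqP.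
have : 2%:R * a = (a + x * b) + (a + - x * b) by ring.
by rewrite hp hn addr0 => /eqP; rewrite mulf_eq0 pnatr_eq0 => /eqP.
Qed.

End Density.

(** * Density of the good pairs in the fibre product *)

Section FibreProductDensity.
Variable K : numClosedFieldType.

Lemma eval_mxM t m n p (A : 'M[{poly K}]_(m, n)) (B : 'M[{poly K}]_(n, p)) :
  eval_mx t (A *m B) = eval_mx t A *m eval_mx t B.
Proof. exact: map_mxM. Qed.

Lemma eval_mxZ t m n d (A : 'M[{poly K}]_(m, n)) :
  eval_mx t (d *: A) = d.[t] *: eval_mx t A.
Proof. exact: map_mxZ. Qed.

(* If [w = (t0 s1 - t1 s0) / (a s0 + b s1)], a coordinate on P^1 vanishing at
   [(t0 : t1)], this is the polynomial in [w] proportional to [p (s1 / s0)]. *)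
Definition recoordinate D (t0 t1 a b : K) (p : {poly K}) : {poly K} :=
  \sum_(k < D.+1) p`_k *: ((t1%:P + a *: 'X) ^+ k * (t0%:P - b *: 'X) ^+ (D - k)).

Lemma recoordinateE D (t0 t1 a b s0 s1 : K) (p : {poly K}) :
  (size p <= D.+1)%N -> a * t0 + b * t1 = 1 -> s0 != 0 -> a * s0 + b * s1 != 0 ->
  (recoordinate D t0 t1 a b p).[(t0 * s1 - t1 * s0) / (a * s0 + b * s1)] =
  (s0 / (a * s0 + b * s1)) ^+ D * p.[s1 / s0].
Proof.
move=> szp ab s00 mu0; set mu := a * s0 + b * s1 in mu0 *.
(* The change of coordinate is inverted: s / mu = (t0 - b w, t1 + a w), thanks to a t0 + b t1 =
   1. *)
set w := (_ / mu); have w0 : t0 - b * w = s0 / mu.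
  rewrite -[s0 in RHS]mul1r -ab /w /mu; field; exact: mu0.
have w1 : t1 + a * w = s1 / mu.
  rewrite -[s1 in RHS]mul1r -ab /w /mu; field; exact: mu0.
have -> : s1 / s0 = (s1 / mu) / (s0 / mu) by field; rewrite mu0.
rewrite -homogenizeE // ?mulf_neq0 ?invr_eq0 // horner_sum.
apply: eq_bigr => k _; rewrite hornerZ hornerM !horner_exp !hornerD hornerN !hornerZ.
by rewrite hornerX !hornerC w0 w1 mulrA.
Qed.

Lemma finite_bound (I : finType) (F : I -> nat) :
  exists D, forall i, (F i <= D)%N.
Proof. by exists (\max_i F i)%N => i; apply: leq_bigmax. Qed.

Lemma bezout2 (t : 'rV[K]_2) : t != 0 -> exists a b, a * t 0 0 + b * t 0 1 = 1.
Proof.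
rewrite [t]pair2_eta => t0; have [t00|t00] := eqVneq (t 0 0) 0; last first.
  by exists (t 0 0)^-1, 0; rewrite pair2_0 mulVf // mul0r addr0.
exists 0, (t 0 1)^-1; rewrite pair2_1 mulVf ?mul0r ?add0r //.
apply: contraNneq t0 => t01; rewrite t00 t01; apply/eqP/rowP => i.
by rewrite [RHS]mxE; have [->|->] := ord2_cases i; rewrite ?pair2_0 ?pair2_1.
Qed.

Section FibreProduct.
Variables (f0 : {poly K}) (n m : nat).
Variables (X UX : set 'rV[K]_n) (f : 'rV[K]_n -> 'rV[K]_2).
Variables (C UC U : set 'rV[K]_m) (h : 'rV[K]_m -> 'rV[K]_2).
Variables (d : nat) (g : 'rV[K]_3 -> 'rV[K]_m) (r : {poly K}).

Definition over_point (v x : K) (c : 'rV[K]_m) : Prop :=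
  same_point (g (point3 1 v x)) c /\ same_point (pair2 1 (x ^+ 2)) (h c).

Hypotheses (irrX : form_irreducible X) (oUX : locally_open X UX).
Hypotheses (neUX : exists p, UX p) (mf : morphism X (@P1 K) f).
Hypothesis dominant_f : forall e (B : 'rV[K]_2 -> K) s, is_form e B ->
  B s != 0 -> s 0 0 != 0 -> exists2 p, X p & B (f p) != 0.
Hypotheses (irrC : form_irreducible C) (mh : morphism C (@P1 K) h).
Hypotheses (hg : form_map d g) (r0 : r != 0).
(** Over a general u, [lift] supplies a point of [UC] above every point of the affine curve, while
    [param] says that a general point of [C] comes from [g]. In the density argument the first
    serves the [X] side and the second the [C] side. *)
Hypothesis lift : forall v x, on_curve f0 v x -> r.[x ^+ 2] != 0 ->
  [/\ v != 0, x != 0 & exists2 c, UC c & over_point v x c].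
Hypotheses (oU : locally_open C U) (neU : exists c, U c).
Hypothesis param : forall c, U c ->
  exists v x, on_curve f0 v x /\ over_point v x c.

Lemma dominant_open l (G : 'rV[K]_2 -> K) s :
  is_form l G -> G s != 0 -> s 0 0 != 0 ->
  locally_open X [set p | X p /\ (P1 (f p) /\ G (f p) != 0)] /\
  exists p, X p /\ (P1 (f p) /\ G (f p) != 0).
Proof.
move=> hG Gs s0; split; first exact: preimage_open mf (form_open (@P1 K) hG).
have [p Xp Gp] := dominant_f hG Gs s0; exists p; split=> //; split=> //.
exact: morphism_maps mf Xp.
Qed.

Lemma fibre_product_nonempty :
  exists p c, [/\ UX p, UC c & same_point (f p) (h c)].
Proof.
(* Nonvanishing of [G] at s means s = (1 : u) with r(u) nonzero; the factor [s 0 0] excludes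
   infinity. *)
pose G (s : 'rV[K]_2) := s 0 0 * homogenize (size r) r (s 0 0) (s 0 1).
have hG : is_form (1 + 1 * size r) G.
  by apply: formM; [|apply: form_homogenize]; exact: form_coord.
have [u0 ru0] := poly_nonroot r0.
have [||oG neG] := dominant_open (s := pair2 1 u0) hG; last 1 first.
- have [p UXp [_ [_]]] := irreducible_openI irrX oUX oG neUX neG.
  rewrite mulf_eq0 negb_or => /andP[s00].
  rewrite homogenizeE // mulf_eq0 negb_or => /andP[_].
  set u := _ / _ => ru; pose x := sqrtC u.
  have xu : x ^+ 2 = u by rewrite sqrtCK.
  have [||_ _ [c UCc [_ hc]]] := @lift (3.-root (x * f0.[x ^+ 2])) x.
  + by rewrite /on_curve rootCK.
  + by rewrite xu.
  exists p, c; split=> //; apply: same_trans hc; apply: same_sym.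
  exists (f p 0 0) => //; rewrite pair2Z mulr1 xu /u mulrC divfK //.
  exact: pair2_eta.
- rewrite /G pair2_0 pair2_1 homogenizeE ?oner_eq0 //.
  by rewrite expr1n !mul1r divr1.
- by rewrite pair2_0 oner_eq0.
Qed.

(* [Q (segre p c)] is a pairing of [A p] with [Y c].  Over a general [u], the
   values of [Y] at the six points of the curve span a space [S_u], and [Q]
   vanishes at [p] paired with these points iff [A p] is orthogonal to [S_u].  The saturation [B] extends
   the bundle [S_u] across [h c]; by density [Y c] belongs to its fibre there, and
   [A p] is orthogonal to it. *)
Lemma fibre_product_density e (Q : 'rV[K]_(n * m) -> K) : is_form e Q ->
  (forall p c, UX p -> UC c -> same_point (f p) (h c) -> Q (segre p c) = 0) ->
  forall p c, X p -> C c -> same_point (f p) (h c) -> Q (segre p c) = 0.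
Proof.
move=> hQ vanish p0 c0 Xp0 Cc0 fh.
have [N [A [Y [hA hY QE]]]] := form_segre_split hQ.
pose y v x := Y (g (point3 1 v x)).
have biv a : bivariate (fun v x => y v x 0 a).
  apply: bivariate_form (form_comp (hY a) hg) (bivariate_point3 _ _ _).
  - exact: bivariate_const. - exact: bivariate_fst. - exact: bivariate_snd.
have [W yE] := curve_decomposition f0 biv.
pose t := h c0; have [a [b ab]] := bezout2 (morphism_maps mh Cc0 : t != 0).
(* The quotient [nu / mu] is a coordinate on the line vanishing at [t], where [mu] is 1. *)
pose mu (s : 'rV[K]_2) := a * s 0 0 + b * s 0 1.
pose nu (s : 'rV[K]_2) := t 0 0 * s 0 1 - t 0 1 * s 0 0.
have hmu : is_form 1 mu by apply: formD; exact/formZ/form_coord.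
have hnu : is_form 1 nu.
  apply: formD; first exact/formZ/form_coord.
  apply: form_ext (formZ (- t 0 1) (form_coord K 0)) _ => s.
  by rewrite mulNr.
have muZ k (s : 'rV[K]_2) : mu (k *: s) = k * mu s by rewrite (form_scale _ _ hmu) expr1.
have nuZ k (s : 'rV[K]_2) : nu (k *: s) = k * nu s by rewrite (form_scale _ _ hnu) expr1.
have [D WD] := finite_bound (fun i : 'I_3 * bool * 'I_N =>
  size (W i.1.1 i.1.2 0 i.2)).
pose rc := recoordinate D (t 0 0) (t 0 1) a b.
pose tW (k : 'I_3) c := map_mx rc (W k c).
have tWE (s : 'rV[K]_2) k c : s 0 0 != 0 -> mu s != 0 ->
    eval_mx (nu s / mu s) (tW k c) =
    (s 0 0 / mu s) ^+ D *: eval_mx (s 0 1 / s 0 0) (W k c).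
  move=> s0 mus; apply/rowP => i; rewrite !mxE /horner_eval recoordinateE //.
  exact/leqW/(WD (k, c, i)).
(* Saturating in the coordinate [nu / mu] instead of u puts [h c0] at the origin even when it is the
   point at infinity. *)
have [B [dB [eB [dB0 eB0 WB orthB]]]] :=
  span_saturation [seq tW kc.1 kc.2 | kc <- enum [set: 'I_3 * bool]%SET].
have {}WB k c : tW k c *m B = dB *: tW k c.
  apply: WB; apply: (map_f (fun kc => tW kc.1 kc.2) (x := (k, c))).
  by rewrite mem_enum inE.
have {}orthB w (u : 'cV[K]_N) : eB.[w] != 0 ->
    (forall k c, eval_mx w (tW k c) *m u = 0) -> eval_mx w B *m u = 0.
  by move=> ew orth; apply: orthB ew _ => _ /mapP[kc _ ->]; exact: orth.
have [E BE] := finite_bound (fun ij : 'I_N * 'I_N => size (B ij.1 ij.2)).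
pose H := maxn (size dB) E.
have BH i j : (size (B i j) <= H.+1)%N.
  by rewrite (leq_trans (BE (i, j))) // leqW // leq_maxr.
have dH : (size dB <= H.+1)%N by rewrite leqW // leq_maxl.
pose hom (p : {poly K}) (s : 'rV[K]_2) := homogenize H p (mu s) (nu s).
have hom_form l (F : 'rV[K]_l -> 'rV[K]_2) l' p :
    form_map l' F -> is_form (l' * H) (fun z => hom p (F z)).
  move=> hF; apply: form_homogenize; rewrite -[l']mul1n; exact: form_comp hF.
have at_base (s : 'rV[K]_2) : same_point s t ->
    mu s != 0 /\ forall p, hom p s = mu s ^+ H * p.[0].
  move=> /same_sym[k k0 ->]; rewrite /hom muZ nuZ.
  have -> : nu t = 0 by rewrite /nu; ring.
  by rewrite mulr0 /mu ab mulr1; split=> // p; rewrite homogenize0.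
have limC : Y c0 *m eval_mx 0 B = dB.[0] *: Y c0.
  have /morphismP[_ /(_ c0 Cc0)[dh [hh [hhf hh0 hhh]]]] := mh.
  have [mu0 hom0] := at_base _ (hhh c0 Cc0 hh0).
  apply/rowP => j; rewrite !mxE.
  (* This is one coordinate of the wanted equation, homogenized into a form in c. It vanishes where
     the parametrization by [g] applies, hence on all of [C]. *)
  pose F c := hom dB (hh c) * Y c 0 j - \sum_i Y c 0 i * hom (B i j) (hh c).
  have hF : is_form (dh * H + e) F.
    apply: formD; first exact: formM (hom_form _ _ _ _ hhf) (hY j).
    apply: form_ext (formZ (-1) (form_sum (d := dh * H + e) (r := index_enum 'I_N)
      (F := fun i c => Y c 0 i * hom (B i j) (hh c)) _)) _ => [i _|c].
      by rewrite addnC; exact: formM (hY i) (hom_form _ _ _ _ hhf).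
    by rewrite mulN1r.
  pose V := [set c | U c /\ (C c /\ mu (hh c) != 0)].
  have hmuh : is_form dh (fun c => mu (hh c)).
    by rewrite -[dh]mul1n; exact: form_comp hhf.
  have oV : locally_open C V := locally_openI oU (form_open C hmuh).
  have neV : exists c, V c.
    have [|c Uc Vc] := irreducible_openI irrC oU (form_open C hmuh) neU.
      by exists c0.
    by exists c.
  suff F0 c : V c -> F c = 0.
    have := form_identity irrC oV neV hF F0 Cc0.
    rewrite /F hom0 => /eqP; rewrite subr_eq0 => /eqP eqF.
    apply: (mulfI (expf_neq0 H mu0)); rewrite mulrA eqF mulr_sumr.
    by apply: eq_bigr => i _; rewrite mxE hom0 mulrCA.
  case=> Uc [Cc muc]; have [v [x [vx [gc xc]]]] := param Uc.
  have hhc0 : hh c != 0.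
    by apply: contraNneq muc => ->; rewrite /mu !mxE !mulr0 addr0.
  have [k k0 hhcE] := same_trans xc (same_sym (hhh c Cc hhc0)).
  have s0 : hh c 0 0 = k by rewrite hhcE mxE pair2_0 mulr1.
  have s1 : hh c 0 1 = k * x ^+ 2 by rewrite hhcE mxE pair2_1.
  have s10 : hh c 0 1 / hh c 0 0 = x ^+ 2 by rewrite s0 s1 mulrC mulKf.
  have s00 : hh c 0 0 != 0 by rewrite s0.
  set w := nu (hh c) / mu (hh c).
  have WE i q : eval_mx (x ^+ 2) (W (i : 'I_3) q) *m eval_mx w B =
      dB.[w] *: eval_mx (x ^+ 2) (W i q).
    have := congr1 (fun V => eval_mx w V) (WB i q).
    rewrite eval_mxM eval_mxZ tWE // s10 -scalemxAl [dB.[w] *: _]scalerA.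
    rewrite [dB.[w] * _]mulrC -scalerA; apply: scalerI.
    by rewrite expf_neq0 // mulf_neq0 ?invr_eq0.
  have YB : Y c *m eval_mx w B = dB.[w] *: Y c.
    have [l _ ->] := same_form_map hY gc.
    rewrite -/(y v x) (yE v x vx) -scalemxAl scalerA [_ * l]mulrC -scalerA.
    congr (_ *: _); rewrite mulmx_suml scaler_sumr; apply: eq_bigr => i _.
    rewrite -scalemxAl mulmxDl -scalemxAl !WE !scalerDr !scalerA.
    by congr (_ *: _ + _ *: _); ring.
  rewrite /F /hom homogenizeE //; apply/eqP; rewrite subr_eq0; apply/eqP.
  have := congr1 (fun Z : 'rV_N => mu (hh c) ^+ H * Z 0 j) YB.
  rewrite !mxE mulr_sumr -/w -mulrA => <-; apply: eq_bigr => i _.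
  by rewrite homogenizeE // mxE mulrCA.
have limX : eval_mx 0 B *m (A p0)^T = 0.
  have /morphismP[_ /(_ p0 Xp0)[df [ff [hff ff0 fff]]]] := mf.
  have [mu0 hom0] := at_base _ (same_trans (fff p0 Xp0 ff0) fh).
  apply/colP => i; rewrite !mxE.
  pose F p := \sum_j hom (B i j) (ff p) * A p 0 j.
  have hF : is_form (df * H + e) F.
    by apply: form_sum => j _; exact: formM (hom_form _ _ _ _ hff) (hA j).
  (* [G1] ensures that u is finite with r(u) nonzero, so that all points over u lift; [G2] keeps the
     coordinate w off the roots of [eB], so that orthogonality passes to [B]. *)
  pose G1 (s : 'rV[K]_2) := s 0 0 * homogenize (size r) r (s 0 0) (s 0 1).
  have hG1 : is_form (1 + 1 * size r) G1.
    by apply: formM; [|apply: form_homogenize]; exact: form_coord.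
  pose G2 s := mu s * homogenize (size eB) eB (mu s) (nu s).
  have hG2 : is_form (1 + 1 * size eB) G2 by apply: formM; last exact: form_homogenize.
  have [oG1 neG1] : locally_open X [set p | X p /\ (P1 (f p) /\ G1 (f p) != 0)] /\
      exists p, X p /\ (P1 (f p) /\ G1 (f p) != 0).
    have [u ru] := poly_nonroot r0; apply: (dominant_open (s := pair2 1 u) hG1).
      rewrite /G1 pair2_0 pair2_1 homogenizeE ?oner_eq0 //.
      by rewrite expr1n !mul1r divr1.
    by rewrite pair2_0 oner_eq0.
  have [oG2 neG2] : locally_open X [set p | X p /\ (P1 (f p) /\ G2 (f p) != 0)] /\
      exists p, X p /\ (P1 (f p) /\ G2 (f p) != 0).
    (* This polynomial is the first coordinate of the point of the line with coordinate w. As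
       [t 0 0] and [b] cannot both vanish, some w avoids its root and those of [eB]. *)
    have l0 : (t 0 0)%:P - b *: 'X != 0 :> {poly K}.
      apply: contra_eq_neq ab => l0; have := congr1 (fun p : {poly K} => p`_0) l0.
      have := congr1 (fun p : {poly K} => p`_1) l0.
      rewrite !coefB !coefC !coefZ !coefX ?coef0 /= mulr0 mulr1 sub0r subr0.
      move=> /eqP; rewrite oppr_eq0 => /eqP -> ->.
      by rewrite mulr0 mul0r addr0 eq_sym oner_eq0.
    have [w] := poly_nonroot (mulf_neq0 eB0 l0).
    rewrite hornerM mulf_eq0 negb_or hornerD hornerN hornerZ hornerX hornerC.
    case/andP=> ew lw; pose s := pair2 (t 0 0 - b * w) (t 0 1 + a * w).
    have mus : mu s = 1.
      by rewrite /mu /s pair2_0 pair2_1 -[RHS]ab; ring.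
    have nus : nu s = w.
      by rewrite /nu /s pair2_0 pair2_1 -[RHS]mul1r -ab; ring.
    apply: (dominant_open (s := s) hG2); last by rewrite pair2_0.
    rewrite /G2 mus nus homogenizeE ?oner_eq0 //.
    by rewrite expr1n !mul1r divr1.
  have hmuf : is_form df (fun p => mu (ff p)).
    by rewrite -[df]mul1n; exact: form_comp hff.
  have oM := form_open X hmuf.
  have neM : exists p, X p /\ mu (ff p) != 0 by exists p0.
  have meet V1 V2 : locally_open X V1 /\ (exists p, V1 p) ->
      locally_open X V2 /\ (exists p, V2 p) ->
      locally_open X [set p | V1 p /\ V2 p] /\ exists p, V1 p /\ V2 p.
    move=> [o1 ne1] [o2 ne2]; split; first exact: locally_openI.
    by have [p] := irreducible_openI irrX o1 o2 ne1 ne2; exists p.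
  have [oV neV] := meet _ _ (meet _ _ (conj oUX neUX) (conj oM neM))
    (meet _ _ (conj oG1 neG1) (conj oG2 neG2)).
  suff F0 p : [set p | (UX p /\ (X p /\ mu (ff p) != 0)) /\
      ((X p /\ (P1 (f p) /\ G1 (f p) != 0)) /\
       (X p /\ (P1 (f p) /\ G2 (f p) != 0)))] p -> F p = 0.
    have := form_identity irrX oV neV hF F0 Xp0.
    rewrite /F => F00; apply: (mulfI (expf_neq0 H mu0)).
    rewrite mulr0 -[RHS]F00 mulr_sumr; apply: eq_bigr => j _.
    by rewrite hom0 !mxE mulrA.
  case=> -[UXp [Xp mup]] [[_ [_ G1p]] [_ [_ G2p]]].
  have ffp0 : ff p != 0.
    by apply: contraNneq mup => ->; rewrite /mu !mxE !mulr0 addr0.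
  have fp := fff p Xp ffp0.
  have {}G1p := same_form hG1 (same_sym fp) G1p.
  have {}G2p := same_form hG2 (same_sym fp) G2p.
  move: G1p; rewrite mulf_eq0 negb_or => /andP[s00].
  rewrite homogenizeE // mulf_eq0 negb_or => /andP[_ ru].
  move: G2p; rewrite mulf_eq0 negb_or => /andP[_].
  rewrite homogenizeE // mulf_eq0 negb_or => /andP[_ ew].
  set u := ff p 0 1 / ff p 0 0 in ru; set w := nu (ff p) / mu (ff p) in ew.
  have fu : same_point (pair2 1 u) (f p).
    apply: same_trans fp; exists (ff p 0 0) => //.
    by rewrite pair2Z mulr1 /u mulrC divfK //; exact: pair2_eta.
  have orth v x : x ^+ 2 = u -> on_curve f0 v x -> y v x *m (A p)^T = 0.
    move=> xu vx; have rx : r.[x ^+ 2] != 0 by rewrite xu.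
    have [_ _ [c UCc [gc hc]]] := lift vx rx.
    have := vanish p c UXp UCc _; rewrite xu in hc.
    move=> /(_ (same_trans (same_sym fu) hc)) Q0.
    apply/rowP => j; rewrite ord1 !mxE.
    have [l l0 cE] := gc; move: Q0; rewrite cE QE => Q0.
    apply: (mulfI (expf_neq0 e l0)); rewrite mulr0 -[RHS]Q0 mulr_sumr.
    by apply: eq_bigr => i' _; rewrite (form_scale _ _ (hY i')) !mxE mulrA.
  have [x xu] : exists x, x ^+ 2 = u by exists (sqrtC u); rewrite sqrtCK.
  have [v vx] : exists v, on_curve f0 v x.
    by exists (3.-root (x * f0.[x ^+ 2])); rewrite /on_curve rootCK.
  have [v0 x0 _] : [/\ v != 0, x != 0 & exists2 c, UC c & over_point v x c].
    by apply: lift vx _; rewrite xu.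
  have Worth := curve_independence yE v0 x0 xu vx orth.
  have /colP/(_ i) : eval_mx w B *m (A p)^T = 0.
    by apply: orthB ew _ => k c; rewrite tWE // -scalemxAl Worth scaler0.
  move=> BA0; rewrite /F.
  transitivity (mu (ff p) ^+ H * (eval_mx w B *m (A p)^T) i 0); last first.
    by rewrite BA0 mxE mulr0.
  rewrite [in RHS]mxE.
  by rewrite mulr_sumr; apply: eq_bigr => j _; rewrite /hom homogenizeE // !mxE mulrA.
(* After multiplication by dB(0) the pairing becomes Y(c0) B(0) A(p0)^T: [limC] inserts [B] next to
   [Y], and [limX] lets it kill [A]. *)
apply: (mulfI dB0); rewrite mulr0 QE.
have -> : \sum_a0 Y c0 0 a0 * A p0 0 a0 = (Y c0 *m (A p0)^T) 0 0.
  by rewrite mxE; apply: eq_bigr => i _; rewrite mxE.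
transitivity ((dB.[0] *: Y c0 *m (A p0)^T) 0 0); first by rewrite -scalemxAl [RHS]mxE.
by rewrite -limC -mulmxA limX mulmx0 mxE.
Qed.

End FibreProduct.
End FibreProductDensity.

(** * The affine curve and norms of forms to the u-line *)

Section MatsumotoTerasoma.
Variable K : numClosedFieldType.

Lemma point3_0 (x y w : K) : point3 x y w 0 ord0 = x.
Proof. by rewrite mxE. Qed.

Lemma point3_1 (x y w : K) : point3 x y w 0 (inord 1) = y.
Proof. by rewrite mxE inordK. Qed.

Lemma point3_2 (x y w : K) : point3 x y w 0 (inord 2) = w.
Proof. by rewrite mxE inordK. Qed.

Lemma form_point3 n d (F G H : 'rV[K]_n -> K) :
  is_form d F -> is_form d G -> is_form d H ->
  form_map d (fun z => point3 (F z) (G z) (H z)).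
Proof.
move=> hF hG hH [[|[|[|i]]] hi] //; by
  [apply: form_ext hF _ => z; rewrite mxE
  |apply: form_ext hG _ => z; rewrite mxE
  |apply: form_ext hH _ => z; rewrite mxE].
Qed.

(** Setting y0 = 1 causes no cancellation, since a monomial of degree 5 in two variables is
    determined by its exponent of y1. *)
Lemma dehomogenized_quintic (F5 : {mpoly K[2]}) :
  F5 \is 5.-homog -> F5 != 0 ->
  exists2 p : {poly K}, p != 0 & forall u, f0 F5 u = p.[u].
Proof.
move=> hF F0; have hm (k : 'X_{1..2}) : k \in msupp F5 -> (k 0%R + k 1%R = 5)%N.
  move=> kF; have <- : mdeg k = 5%N := dhomog_mf hF kF.
  rewrite mdegE !big_ord_recl big_ord0 addn0; congr (k _ + k _)%N; exact: val_inj.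
exists (\sum_(k <- msupp F5) F5@_k *: 'X^(k 1%R)); last first.
  move=> u; rewrite /f0 mevalE horner_sum; apply: eq_bigr => k _.
  rewrite !big_ord_recl big_ord0 mulr1 hornerZ hornerXn.
  have -> : lift ord0 ord0 = 1 :> 'I_2 by exact: val_inj.
  by rewrite (pair2_0 1 u) (pair2_1 1 u) expr1n mul1r.
have [k0 k0F] : exists k, k \in msupp F5.
  move: F0; rewrite -msupp_eq0; case: (msupp F5) => // k s _.
  by exists k; rewrite mem_head.
apply/eqP => /(congr1 (fun p : {poly K} => p`_(k0 1%R))).
rewrite coef_sum coef0 (bigD1_seq k0) ?msupp_uniq //= coefZ coefXn eqxx mulr1.
rewrite big_seq_cond big1 ?addr0 => [/eqP|k /andP[kF kk0]].
  by rewrite mcoeff_eq0 k0F.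
rewrite coefZ coefXn; case: eqP => [k1|]; last by rewrite mulr0.
case/eqP: kk0; apply/mnmP => i.
have k00 : k 0%R = k0 0%R by apply/eqP; rewrite -(eqn_add2r (k 1%R)) hm // -k1 hm.
by have [->|->] := ord2_cases i.
Qed.

Lemma irreducible_prod n (V : set 'rV[K]_n) (I : Type) (r : seq I) d
    (F : I -> 'rV[K]_n -> K) :
  form_irreducible V -> (exists x, V x) -> (forall i, is_form (d i) (F i)) ->
  (forall i, exists2 x, V x & F i x != 0) ->
  exists2 x, V x & \prod_(i <- r) F i x != 0.
Proof.
move=> irrV [x0 Vx0] hF neF; elim: r => [|i r IH].
  by exists x0; rewrite ?big_nil ?oner_eq0.
have [x [Vx Fx Px]] := irrV _ _ _ _ (hF i) (form_prod r hF) (neF i) IH.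
by exists x => //; rewrite big_cons mulf_neq0.
Qed.

Section Curve.
Variables (F5 : {mpoly K[2]}) (p : {poly K}).
Hypothesis pE : forall u, f0 F5 u = p.[u].

Lemma affine_MT_curveP z : affine_MT_curve F5 z <->
  exists v x, on_curve p v x /\ same_point (point3 1 v x) z.
Proof.
split=> -[v [x [vx h]]]; exists v, x; split=> //.
  by apply/eqP; rewrite -subr_eq0 -pE vx.
by rewrite pE; apply/eqP; rewrite subr_eq0; apply/eqP.
Qed.

Lemma affine_MT_curve_nonzero : nonzero_set (affine_MT_curve F5).
Proof.
move=> z /affine_MT_curveP[v [x [_ h]]]; apply: same_neq0 h _.
by rewrite point3_eq0 oner_eq0.
Qed.

Lemma affine_MT_curve_point v x :
  on_curve p v x -> affine_MT_curve F5 (point3 1 v x).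
Proof.
by move=> vx; apply/affine_MT_curveP; exists v, x; split=> //; exact: same_refl.
Qed.

(* [r (x^2)] is the norm of [T] to the [u]-line, [u = x^2]: the product of its
   values at the six points [(om^i v, x)] and [(- om^i v, - x)] over [u]. *)
Lemma curve_norm d (T : 'rV[K]_3 -> K) :
  form_irreducible (affine_MT_curve F5) -> is_form d T ->
  (exists2 z, affine_MT_curve F5 z & T z != 0) ->
  exists2 r : {poly K}, r != 0 & forall v x, on_curve p v x ->
    r.[x ^+ 2] != 0 -> T (point3 1 v x) != 0.
Proof.
move=> irr hT [q1 Mq1 Tq1]; have [om om2 om3] := cube_root_unity K.
have omc i v x : on_curve p v x -> on_curve p (om ^+ i * v) x.
  by move=> vx; rewrite /on_curve exprMn exprAC om3 expr1n mul1r.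
have negc v x : on_curve p v x -> on_curve p (- v) (- x).
  by rewrite /on_curve => vx; rewrite sqrrN mulNr -vx; ring.
(* The product over the three sheets is invariant under v -> om v, so only the component [P 0]
   survives: a polynomial in x alone. *)
pose H v x := T (point3 1 v x) * T (point3 1 (om * v) x) * T (point3 1 (om ^+ 2 * v) x).
have biv : bivariate H.
  have bivT c : bivariate (fun v x => T (point3 1 (c * v) x)).
    apply: bivariate_form hT (bivariate_point3 (bivariate_const 1) _ _).
      exact: bivariateM (bivariate_const c) (bivariate_fst K).
    exact: bivariate_snd.
  apply: bivariateM (bivT _); apply: bivariateM (bivT _).
  by apply: bivariate_ext (bivT 1) _ => v x; rewrite mul1r.
have [P PE] := cyclic_cover_decomposition ('X * (p \Po 'X^2)) (isT : 0 < 3)%N biv.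
have {}PE v x : on_curve p v x -> H v x = (P 0%N).[x].
  move=> vx; have H1 i : H (om ^+ i * v) x = H v x.
    elim: i => [|i <-]; first by rewrite expr0 mul1r.
    rewrite exprS -mulrA /H; set v1 := om ^+ i * v.
    have -> : om * (om * v1) = om ^+ 2 * v1 by ring.
    have -> : om ^+ 2 * (om * v1) = om ^+ 3 * v1 by ring.
    by rewrite om3 mul1r; ring.
  suff [/eqP] : [/\ (P 0%N).[x] - H v x = 0, v * (P 1%N).[x] = 0 &
      v ^+ 2 * (P 2%N).[x] = 0] by rewrite subr_eq0 => /eqP.
  apply: cyclic_system om2 _ => i _; rewrite -(H1 i) PE.
    by rewrite !big_ord_recl big_ord0 /= /bump /=; ring.
  by rewrite hornerM hornerX horner_comp hornerXn; exact: omc.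
pose r := even_poly (P 0%N) ^+ 2 - 'X * odd_poly (P 0%N) ^+ 2.
have rE x : r.[x ^+ 2] = (P 0%N).[x] * (P 0%N).[- x].
  have PP y : (P 0%N).[y] =
      (even_poly (P 0%N)).[y ^+ 2] + (odd_poly (P 0%N)).[y ^+ 2] * y.
    rewrite -[in LHS](poly_even_odd (P 0%N)) hornerD hornerM hornerX.
    by rewrite !horner_comp hornerXn.
  rewrite !PP sqrrN /r !expr2 hornerD hornerN !hornerM hornerX -expr2; ring.
exists r; last first.
  move=> v x vx; rewrite rE -(PE v x vx) !mulf_eq0 !negb_or.
  by case/andP=> /andP[/andP[]].
(* These linear maps are the six automorphisms of the curve over the u-line. [T] composed with each
   is nonzero somewhere, so by irreducibility all six factors of the norm are nonzero at one point,
   and [r] is not 0. *)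
pose S (k : nat * bool) (z : 'rV[K]_3) := point3 (z 0 ord0)
  ((-1) ^+ k.2 * om ^+ k.1 * z 0 (inord 1)) ((-1) ^+ k.2 * z 0 (inord 2)).
have hS k : form_map 1 (S k).
  by apply: form_point3; [|apply: formZ|apply: formZ]; exact: form_coord.
have ne k : exists2 z, affine_MT_curve F5 z & T (S k z) != 0.
  have /affine_MT_curveP[v [x [vx h]]] := Mq1.
  (* A preimage of [q1] under [S k]: the inverse of om^i is om^(2i), and the sign is its own
     inverse. *)
  exists (point3 1 ((-1) ^+ k.2 * om ^+ k.1 ^+ 2 * v) ((-1) ^+ k.2 * x)).
    apply: affine_MT_curve_point; rewrite -mulrA -exprM.
    by case: k.2; rewrite ?expr1 ?expr0 ?mulN1r ?mul1r; [apply: negc|]; exact: omc.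
  rewrite /S point3_0 point3_1 point3_2; set sg := (-1) ^+ k.2; set o := om ^+ k.1.
  have sg2 : sg ^+ 2 = 1 by rewrite sqrr_sign.
  have o3 : o ^+ 3 = 1 by rewrite exprAC om3 expr1n.
  have -> : sg * o * (sg * o ^+ 2 * v) = sg ^+ 2 * o ^+ 3 * v by ring.
  rewrite mulrA -expr2 sg2 o3 !mul1r.
  exact: same_form hT (same_sym h) Tq1.
have [z Mz] := irreducible_prod
  [seq (i, s) | i <- [:: 0%N; 1%N; 2%N], s <- [:: true; false]] irr (ex_intro _ _ Mq1) (fun k => form_comp hT (hS k)) ne.
have /affine_MT_curveP[v [x [vx h]]] := Mz.
rewrite !big_cons big_nil !mulf_eq0 !negb_or.
have TS k : T (S k z) != 0 ->
    T (point3 1 ((-1) ^+ k.2 * om ^+ k.1 * v) ((-1) ^+ k.2 * x)) != 0.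
  move=> nT; apply: same_form hT _ nT.
  have := same_form_map (hS k) (same_sym h).
  by rewrite [S k (point3 _ _ _)]/S point3_0 point3_1 point3_2.
case/and5P => /TS t1 /TS t2 /TS t3 /TS t4 /and3P[/TS t5 /TS t6 _].
apply: contraTneq isT => r_eq0; have := rE x; rewrite r_eq0 horner0 => /esym/eqP.
rewrite -(PE v x vx) -(PE _ _ (negc _ _ vx)) /H.
move: t1 t2 t3 t4 t5 t6; rewrite /= !expr0 !expr1 ?mulN1r ?mulNr ?mul1r ?mulrN.
by rewrite !mulf_eq0; do 6!move=> /negPf ->.
Qed.

End Curve.
End MatsumotoTerasoma.

(** * Lifting general points of the affine curve to the smooth model *)

Section CurveLift.
Variable K : numClosedFieldType.
Variables (F5 : {mpoly K[2]}) (p : {poly K}) (m : nat).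
Variables (C UC0 : set 'rV[K]_m) (h : 'rV[K]_m -> 'rV[K]_2).
Variables (UC' : set 'rV[K]_3) (kappa : 'rV[K]_m -> 'rV[K]_3).
Variable (psi : 'rV[K]_3 -> 'rV[K]_m).

(** The map to the cubic divides by x; its inverse divides by X, which is proportional to v. *)
Definition off_axes (z : 'rV[K]_3) : K := z 0 (inord 1) * z 0 (inord 2).

Lemma off_axes_form : is_form 2 off_axes.
Proof. exact: formM (form_coord _ _) (form_coord _ _). Qed.

Definition curve_domain : set 'rV[K]_m :=
  [set c | UC0 c /\ (UC' (kappa c) /\ off_axes (kappa c) != 0)].

Hypotheses (pE : forall u, f0 F5 u = p.[u]) (p0 : p != 0).
Hypotheses (irrC : form_irreducible C) (oUC0 : locally_open C UC0).
Hypothesis dUC' : dense_open (affine_MT_curve F5) UC'.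
Hypothesis inv : mutually_inverse UC0 UC' kappa psi.
Hypothesis hE : forall c v x, UC0 c -> same_point (point3 1 v x) (kappa c) ->
  same_point (pair2 1 (x ^+ 2)) (h c).

Lemma curve_domain_open : locally_open C curve_domain.
Proof.
have [mk _ _ _] := inv.
exact: locally_open_trans oUC0 (preimage_open mk (form_open UC' off_axes_form)).
Qed.

Lemma curve_domain_coordinates c : curve_domain c -> exists v x,
  [/\ on_curve p v x, v != 0, x != 0, same_point (point3 1 v x) (kappa c) &
    same_point (pair2 1 (x ^+ 2)) (h c)].
Proof.
case=> Uc [Uk off]; have nMT := affine_MT_curve_nonzero pE.
have [[UM _] _] := dense_openP nMT dUC'.
have /(affine_MT_curveP pE)[v [x [vx vxE]]] := UM _ Uk.
have := same_form off_axes_form (same_sym vxE) off.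
rewrite /off_axes point3_1 point3_2 mulf_eq0 negb_or => /andP[v0 x0].
by exists v, x; split=> //; exact: hE vxE.
Qed.

(** One tuple of forms [g] represents [psi] only near a chosen point [q1]. The form [T] collects the
    conditions for a point to be good, and its norm [r] turns them into one condition on u, which
    then holds at all points over u at once. *)
Lemma curve_lift : exists d g (r : {poly K}) U,
  [/\ form_map d g, r != 0,
    forall v x, on_curve p v x -> r.[x ^+ 2] != 0 ->
      [/\ v != 0, x != 0 & exists2 c, curve_domain c & over_point h g v x c],
    locally_open C U /\ (exists c, U c) &
    forall c, U c -> exists v x, on_curve p v x /\ over_point h g v x c].
Proof.
have nMT := affine_MT_curve_nonzero pE.
have [oUC' dns] := dense_openP nMT dUC'.
have [mk mpsi kpsi psik] := inv.
have irrMT := birational_irreducible nMT irrC oUC0 dUC' inv.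
have [q1 Uq1 [Mq1 off1]] : exists2 q, UC' q &
    affine_MT_curve F5 q /\ off_axes q != 0.
  apply: dns (form_open _ off_axes_form) _.
  have [|u] := @poly_nonroot K (p * 'X); first by rewrite mulf_neq0 ?polyX_eq0.
  rewrite hornerM hornerX mulf_eq0 negb_or => /andP[pu u0].
  pose x := sqrtC u; have xu : x ^+ 2 = u by rewrite sqrtCK.
  have x0 : x != 0 by apply: contraNneq u0 => x0; rewrite -xu x0 expr0n.
  pose v := 3.-root (x * p.[u]); have vE : v ^+ 3 = x * p.[u] by rewrite rootCK.
  have v0 : v != 0.
    have : v ^+ 3 != 0 by rewrite vE mulf_neq0.
    by rewrite expf_eq0.
  exists (point3 1 v x); split; last by rewrite /off_axes point3_1 point3_2 mulf_neq0.
  by apply: affine_MT_curve_point; rewrite ?pE // /on_curve xu.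
have /morphismP[_ /(_ q1 Uq1)[d [g [hg gq1 gpsi]]]] := mpsi.
have [j gj] := row_neq0P gq1.
have [_ /(_ q1 Uq1)[dS [S [hS Sq1 SU]]]] := oUC'.
pose T z := S z * off_axes z * g z 0 j.
have hT : is_form (dS + 2 + d) T.
  exact: formM (formM hS off_axes_form) (hg j).
have Tne : exists2 z, affine_MT_curve F5 z & T z != 0.
  by exists q1 => //; exact: mulf_neq0 (mulf_neq0 Sq1 off1) gj.
have TE z : affine_MT_curve F5 z -> T z != 0 ->
    [/\ UC' z, off_axes z != 0 & same_point (g z) (psi z)].
  move=> Mz; rewrite mulf_eq0 negb_or => /andP[].
  rewrite mulf_eq0 negb_or => /andP[Sz offz] /row_neq0 gz.
  by have Uz := SU z Mz Sz; split=> //; exact: gpsi.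
have [r r0 rT] := curve_norm pE irrMT hT Tne.
exists d, g, r, [set c | UC0 c /\ (UC' (kappa c) /\ T (kappa c) != 0)]; split=> //.
- move=> v x vx rx.
  have [Uq offq gq] := TE _ (affine_MT_curve_point pE vx) (rT v x vx rx).
  have := offq; rewrite /off_axes point3_1 point3_2 mulf_eq0 negb_or.
  case/andP=> v0 x0; split=> //; set q := point3 1 v x in Uq offq gq.
  have Up : UC0 (psi q) := morphism_maps mpsi Uq.
  exists (psi q); last by split=> //; exact: hE Up (psik q Uq).
  split=> //; split; first exact: morphism_maps mk Up.
  exact: same_form off_axes_form (psik q Uq) offq.
- split; first exact: locally_open_trans oUC0 (preimage_open mk (form_open UC' hT)).
  have Up : UC0 (psi q1) := morphism_maps mpsi Uq1.
  exists (psi q1); split=> //; split; first exact: morphism_maps mk Up.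
  apply: same_form hT (psik q1 Uq1) _.
  exact: mulf_neq0 (mulf_neq0 Sq1 off1) gj.
- move=> c [Uc [Uk Tk]]; have [UM _] := oUC'.
  have /(affine_MT_curveP pE)[v [x [vx vxE]]] := UM _ Uk.
  exists v, x; split=> //; split; last exact: hE vxE.
  have [_ _ gk] := TE _ (UM _ Uk) Tk.
  apply: same_trans (same_form_map hg vxE) (same_trans gk _).
  exact: same_sym (kpsi c Uc).
Qed.

End CurveLift.

(** * Coordinates on the double plane *)

Section DoublePlane.
Variable K : numClosedFieldType.

Lemma row_mx_point3 (y : 'rV[K]_2) (y2 : K) :
  row_mx y y2%:M = point3 (y 0 0) (y 0 1) y2.
Proof.
apply/rowP => i; rewrite !mxE; case: splitP => [j ij|j].
  by rewrite ij; have [->|->] := ord2_cases j.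
by rewrite ord1 mxE eqxx mulr1n => ->.
Qed.

Definition cubic_index (i j k : 'I_3) : 'I_(3 * (3 * 3) + 1) :=
  lshift 1 (mxvec_index i (mxvec_index j k)).

Definition weight3_index : 'I_(3 * (3 * 3) + 1) := rshift (3 * (3 * 3)) ord0.

Lemma double_plane_pointE (y : 'rV[K]_2) (y2 w : K) i j k :
  double_plane_point y y2 w 0 (cubic_index i j k) =
  point3 (y 0 0) (y 0 1) y2 0 i * (point3 (y 0 0) (y 0 1) y2 0 j *
    point3 (y 0 0) (y 0 1) y2 0 k).
Proof. by rewrite row_mxEl !segreE row_mx_point3. Qed.

Lemma double_plane_pointEw (y : 'rV[K]_2) (y2 w : K) :
  double_plane_point y y2 w 0 weight3_index = w.
Proof. by rewrite row_mxEr mxE eqxx mulr1n. Qed.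

Lemma double_plane_pointZ s (y : 'rV[K]_2) (y2 w : K) :
  double_plane_point (s *: y) (s * y2) (s ^+ 3 * w) =
  s ^+ 3 *: double_plane_point y y2 w.
Proof.
rewrite /double_plane_point.
have -> : row_mx (s *: y) (s * y2)%:M = s *: row_mx y y2%:M :> 'rV_3.
  by rewrite -scale_scalar_mx scale_row_mx.
by rewrite !segreZ -scale_scalar_mx scale_row_mx; congr (row_mx (_ *: _) _).
Qed.

Lemma double_plane_point_neq0 (y : 'rV[K]_2) (y2 w : K) :
  (y != 0) || (y2 != 0) -> double_plane_point y y2 w != 0.
Proof.
move=> yn; have : row_mx y y2%:M != 0 :> 'rV[K]_3.
  rewrite row_mx_point3 point3_eq0; apply: contraTN yn.
  case/and3P=> /eqP y00 /eqP y01 /eqP ->; rewrite eqxx orbF negbK [y]pair2_eta.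
  have -> : pair2 (y 0 0) (y 0 1) = 0 *: pair2 1 1 by rewrite y00 y01 pair2Z !mul0r.
  by rewrite scale0r.
rewrite /double_plane_point => P0; rewrite row_mx_eq0 negb_and.
by rewrite !segre_neq0 P0.
Qed.

Variables F2 F5 : {mpoly K[2]}.

Lemma double_plane_nonzero : nonzero_set (double_plane F2 F5).
Proof.
by move=> z [y [y2 [w [yn _ h]]]]; exact: same_neq0 h (double_plane_point_neq0 _ yn).
Qed.

Lemma double_plane_cone : cone (double_plane F2 F5).
Proof.
move=> z z' zz' [y [y2 [w [yn eq h]]]]; exists y, y2, w; split=> //.
exact: same_trans h zz'.
Qed.

End DoublePlane.

(** * The explicit maps between the double plane and the cubic *)

Section Maps.
Variables (K : numClosedFieldType) (beta : K).

Let i1 : 'I_3 := inord 1.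
Let i2 : 'I_3 := inord 2.

(* With [D] the point [(1, x^2, y2, w)] of the double plane and [M = (1, v, x)],
   this is the point [(X, Y) = (beta^2 v / (x y2), beta^3 w / (x y2^2))] of
   [Y^2 = X^3 + beta^6]. *)
Definition cubic_map (z : 'rV[K]_((3 * (3 * 3) + 1) * 3)) : 'rV[K]_3 := point3
  (beta ^+ 2 * z 0 (mxvec_index (cubic_index ord0 ord0 i2) i1))
  (beta ^+ 3 * z 0 (mxvec_index weight3_index ord0))
  (z 0 (mxvec_index (cubic_index ord0 i2 i2) i2)).

Lemma cubic_map_form : form_map 1 cubic_map.
Proof.
by apply: form_point3; [apply: formZ|apply: formZ|]; exact: form_coord.
Qed.

Lemma cubic_mapE (y : 'rV[K]_2) (y2 w v x : K) :
  cubic_map (segre (double_plane_point y y2 w) (point3 1 v x)) =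
  point3 (beta ^+ 2 * (y 0 0 ^+ 2 * y2 * v)) (beta ^+ 3 * w) (y 0 0 * y2 ^+ 2 * x).
Proof.
rewrite /cubic_map !segreE !double_plane_pointE double_plane_pointEw.
by rewrite !point3_0 !point3_1 !point3_2; congr point3; ring.
Qed.

Section Inverse.
Variable z : 'rV[K]_(3 * 3).
Let Z i j := z 0 (mxvec_index i j).
(** Over y = (1, x^2), solving for y2 and w gives y2 = beta^2 v W / (x X) and w = beta v^2 Y W / (x
    X^2). Rescaling by s = x X W^2 with weights 1, 1, 1, 3 clears the denominators. The factor W^2
    gives s degree 3 in (X, Y, W), matching the x^3 in s x^2, so that everything is a form in the
    entries of a Segre vector. *)
Definition inverse_y := pair2 (Z ord0 ord0 * Z ord0 i2 * Z i2 i2)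
  (Z i2 ord0 * Z i2 i2 * Z i2 i2).
Definition inverse_y2 := beta ^+ 2 * (Z ord0 i2 * Z ord0 i2 * Z i1 i2).
Definition inverse_w := beta * (Z ord0 ord0 * Z ord0 i1 * Z ord0 i2 ^+ 3 *
  Z i1 i2 ^+ 2 * Z i2 i2 ^+ 2).
Definition plane_map : 'rV[K]_(3 * (3 * 3) + 1) :=
  double_plane_point inverse_y inverse_y2 inverse_w.
End Inverse.

Lemma plane_map_form : form_map 9 plane_map.
Proof.
have hZ i j : is_form 1 (fun z : 'rV[K]_(3 * 3) => z 0 (mxvec_index i j)).
  exact: form_coord.
have h3 : form_map 3 (fun z => row_mx (inverse_y z) (inverse_y2 z)%:M : 'rV[K]_3).
  have : form_map 3 (fun z => point3 (inverse_y z 0 0) (inverse_y z 0 1) (inverse_y2 z)).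
    apply: form_point3.
    - apply: (form_ext (formM (formM (hZ ord0 ord0) (hZ ord0 i2)) (hZ i2 i2))).
      by move=> z; rewrite /inverse_y pair2_0.
    - apply: (form_ext (formM (formM (hZ i2 ord0) (hZ i2 i2)) (hZ i2 i2))).
      by move=> z; rewrite /inverse_y pair2_1.
    - exact: formZ (formM (formM (hZ _ _) (hZ _ _)) (hZ _ _)).
  by move=> h3 i; apply: form_ext (h3 i) _ => z; rewrite row_mx_point3.
move=> i; rewrite -(splitK i); case: (split i) => j.
  apply: form_ext (segre_form h3 (segre_form h3 h3) j) _ => z.
  by rewrite /= row_mxEl.
apply: (@form_ext _ _ 9%N inverse_w); last first.
  by move=> z; rewrite /= row_mxEr ord1 mxE eqxx mulr1n.
apply: formZ; have -> : 9%N = (1 + 1 + 1 * 3 + 1 * 2 + 1 * 2)%N by [].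
exact: formM (formM (formM (formM (hZ _ _) (hZ _ _)) (formX 3 (hZ _ _)))
  (formX 2 (hZ _ _))) (formX 2 (hZ _ _)).
Qed.

Lemma plane_mapE (v x X Y W : K) :
  plane_map (segre (point3 1 v x) (point3 X Y W)) =
  double_plane_point ((x * X * W ^+ 2) *: pair2 1 (x ^+ 2))
    (beta ^+ 2 * (v * W ^+ 3)) (beta * (X * Y * W ^+ 7 * v ^+ 2 * x ^+ 2)).
Proof.
rewrite /plane_map; congr double_plane_point.
- by rewrite /inverse_y pair2Z !segreE !point3_0 !point3_2; congr pair2; ring.
- by rewrite /inverse_y2 !segreE !point3_0 !point3_1 !point3_2; ring.
- by rewrite /inverse_w !segreE !point3_0 !point3_1 !point3_2; ring.
Qed.

Lemma plane_map_cubic_map (y2 w v x : K) :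
  beta != 0 -> v != 0 -> x != 0 -> y2 != 0 ->
  let D := double_plane_point (pair2 1 (x ^+ 2)) y2 w in
  let M := point3 1 v x in
  same_point D (plane_map (segre M (cubic_map (segre D M)))).
Proof.
move=> b0 v0 x0 y20 D M; rewrite /D /M cubic_mapE pair2_0 plane_mapE.
set X := beta ^+ 2 * _; set W := 1 * _ * x; pose s := x * X * W ^+ 2.
exists (s ^+ 3).
  by rewrite /s /X /W expr1n !mul1r !expf_neq0 // !mulf_neq0 // !expf_neq0 //
    mulf_neq0 // expf_neq0.
rewrite -double_plane_pointZ; congr double_plane_point.
- by rewrite /s /X /W; ring.
- by rewrite /s /X /W; ring.
Qed.

Lemma cubic_map_plane_map (v x X Y W : K) :
  beta != 0 -> v != 0 -> x != 0 -> X != 0 -> W != 0 ->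
  let M := point3 1 v x in let e := point3 X Y W in
  same_point e (cubic_map (segre (plane_map (segre M e)) M)).
Proof.
move=> b0 v0 x0 X0 W0 M e; rewrite /M /e plane_mapE pair2Z cubic_mapE pair2_0.
exists (beta ^+ 4 * (v ^+ 2 * x ^+ 2 * X * W ^+ 7)).
  by rewrite !mulf_neq0 // expf_neq0.
rewrite point3Z.
by congr point3; ring.
Qed.

Hypothesis beta0 : beta != 0.
Variables (F2 F5 : {mpoly K[2]}) (p : {poly K}).
Hypotheses (F2E : F2 = 'X_0 * 'X_1) (hF5 : F5 \is 5.-homog).
Hypothesis pE : forall u, f0 F5 u = p.[u].

Lemma F5_pencil s u : F5.@[(s *: pair2 1 u) 0] = s ^+ 5 * p.[u].
Proof.
have hf : is_form 5 (fun y : 'rV[K]_2 => F5.@[y 0]) by exists F5.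
by rewrite (form_scale s _ hf) -pE.
Qed.

Lemma F2_value (y : 'rV[K]_2) : F2.@[y 0] = y 0 0 * y 0 1.
Proof. by rewrite F2E mevalM !mevalXU. Qed.

(** The equation of the double plane is multiplied by beta^6 x y2^2, after which x f0(x^2) becomes
    v^3. *)
Lemma cubic_map_weierstrass (y2 w v x : K) :
  on_curve p v x -> x != 0 -> y2 != 0 ->
  w ^+ 2 = y2 * (x ^+ 2 * y2 ^+ 3 + p.[x ^+ 2]) ->
  weierstrass_cubic 0 (beta ^+ 6) (cubic_map
    (segre (double_plane_point (pair2 1 (x ^+ 2)) y2 w) (point3 1 v x))).
Proof.
move=> vx x0 y20 eq; rewrite cubic_mapE pair2_0; apply/weierstrassP; split.
  rewrite point3_eq0 !negb_and mul1r; apply/or3P; constructor 3.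
  by rewrite mulf_neq0 // expf_neq0.
transitivity (beta ^+ 6 * w ^+ 2 * (y2 ^+ 2 * x)); first by ring.
rewrite eq; transitivity (beta ^+ 6 * (y2 ^+ 3 * v ^+ 3 + x ^+ 3 * y2 ^+ 6)); last by ring.
by rewrite vx; ring.
Qed.

Lemma plane_map_double_plane (v x X Y W : K) :
  on_curve p v x -> v != 0 -> W != 0 ->
  weierstrass_cubic 0 (beta ^+ 6) (point3 X Y W) ->
  double_plane F2 F5 (plane_map (segre (point3 1 v x) (point3 X Y W))).
Proof.
move=> vx v0 W0 /weierstrassP[_ eq]; rewrite plane_mapE.
eexists _, _, _; split; last exact: same_refl.
  by rewrite orbC !mulf_neq0 // expf_neq0.
rewrite F5_pencil F2_value pair2Z pair2_0 pair2_1.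
transitivity (beta ^+ 2 * X ^+ 2 * W ^+ 13 * v ^+ 4 * x ^+ 4 * (Y ^+ 2 * W)).
  by ring.
rewrite eq; set q := p.[_].
transitivity (beta ^+ 2 * v * W ^+ 13 * (v ^+ 3 * x ^+ 4 * X ^+ 5
  + beta ^+ 6 * (v * v * v) * x ^+ 4 * X ^+ 2 * W ^+ 3)); first by ring.
by rewrite vx -/q; ring.
Qed.

End Maps.

(** * The birational map and its inverse on explicit open subsets *)

Section Assembly.
Variables (K : numClosedFieldType) (F2 F5 : {mpoly K[2]}) (p : {poly K}).
Hypotheses (F2E : F2 = 'X_0 * 'X_1) (hF5 : F5 \is 5.-homog).
Hypotheses (pE : forall u, f0 F5 u = p.[u]) (p_neq0 : p != 0).
Variables (beta : K) (beta0 : beta != 0).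
Variables (n : nat) (X UX0 : set 'rV[K]_n) (f : 'rV[K]_n -> 'rV[K]_2).
Variables (DP' : set 'rV[K]_(3 * (3 * 3) + 1)).
Variables (pi : 'rV[K]_n -> 'rV[K]_(3 * (3 * 3) + 1)).
Variable piV : 'rV[K]_(3 * (3 * 3) + 1) -> 'rV[K]_n.
Hypotheses (nX : nonzero_set X) (cX : cone X) (irrX : form_irreducible X).
Hypotheses (mf : morphism X (@P1 K) f) (oUX0 : locally_open X UX0).
Hypothesis dDP' : dense_open (double_plane F2 F5) DP'.
Hypothesis invX : mutually_inverse UX0 DP' pi piV.
Hypothesis fE : forall z (y : 'rV[K]_2) y2 w, UX0 z -> y != 0 ->
  same_point (double_plane_point y y2 w) (pi z) -> same_point y (f z).
Variables (m : nat) (C UC0 : set 'rV[K]_m) (h : 'rV[K]_m -> 'rV[K]_2).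
Variables (MT' : set 'rV[K]_3) (kappa : 'rV[K]_m -> 'rV[K]_3).
Variable kappaV : 'rV[K]_3 -> 'rV[K]_m.
Hypotheses (nC : nonzero_set C) (cC : cone C) (irrC : form_irreducible C).
Hypotheses (mh : morphism C (@P1 K) h) (oUC0 : locally_open C UC0).
Hypothesis dMT' : dense_open (affine_MT_curve F5) MT'.
Hypothesis invC : mutually_inverse UC0 MT' kappa kappaV.
Hypothesis hE : forall c v x, UC0 c -> same_point (point3 1 v x) (kappa c) ->
  same_point (pair2 1 (x ^+ 2)) (h c).

Notation DP := (double_plane F2 F5).
Notation E := (@weierstrass_cubic K 0 (beta ^+ 6)).
Notation Z := (pullback X f C h).
Notation CE := (prod_variety C E).

Let i2 : 'I_3 := inord 2.
Let UC := curve_domain UC0 MT' kappa.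
(** On the double plane this coordinate is y0^2 y2, so a single condition places a point in the
    chart y0 = 1 and off the branch line y2 = 0. *)
Let c002 (D : 'rV[K]_(3 * (3 * 3) + 1)) := D 0 (cubic_index ord0 ord0 i2).
Let c002_form : is_form 1 c002 := form_coord K _.
Let UX := [set z | UX0 z /\ (DP' (pi z) /\ c002 (pi z) != 0)].

Lemma c002E (y : 'rV[K]_2) y2 w :
  c002 (double_plane_point y y2 w) = y 0 0 ^+ 2 * y2.
Proof. by rewrite /c002 double_plane_pointE point3_0 point3_2; ring. Qed.

Lemma double_plane_over (y : 'rV[K]_2) y2 : y != 0 ->
  exists w, DP (double_plane_point y y2 w).
Proof.
move=> y0; pose w := sqrtC (y2 * (F2.@[y 0] * y2 ^+ 3 + F5.@[y 0])); exists w.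
by exists y, y2, w; split; [rewrite y0|rewrite sqrtCK|exact: same_refl].
Qed.

Lemma UX_open : locally_open X UX.
Proof.
have [mpi _ _ _] := invX.
exact: locally_open_trans oUX0 (preimage_open mpi (form_open DP' c002_form)).
Qed.

Lemma UX_nonempty : exists z, UX z.
Proof.
have [mpi mpiV _ piK] := invX.
have [_ dns] := dense_openP (@double_plane_nonzero K F2 F5) dDP'.
have [|D D' [_ cD]] := dns _ (form_open DP c002_form).
  have y0 : pair2 1 0 != 0 :> 'rV[K]_2.
    by apply: (@row_neq0 _ _ _ 0); rewrite pair2_0 oner_eq0.
  have [w hD] := double_plane_over 1 y0.
  exists (double_plane_point (pair2 1 0) 1 w); split=> //.
  by rewrite c002E pair2_0 expr1n mulr1 oner_eq0.
have Uz : UX0 (piV D) := morphism_maps mpiV D'.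
exists (piV D); split=> //; split; first exact: morphism_maps mpi Uz.
exact: same_form c002_form (piK D D') cD.
Qed.

(** The double plane has a point over every s, and [c] reads y0^2 y off it. The extra factor y0^3
    forces y to be nonzero, so that [fE] identifies f z with y. *)
Lemma f_dominant e (B : 'rV[K]_2 -> K) s : is_form e B ->
  B s != 0 -> s 0 0 != 0 -> exists2 z, X z & B (f z) != 0.
Proof.
move=> hB Bs s0; have [mpi mpiV _ piK] := invX.
have [oDP' dns] := dense_openP (@double_plane_nonzero K F2 F5) dDP'.
pose c (D : 'rV[K]_(3 * (3 * 3) + 1)) := pair2
  (D 0 (cubic_index ord0 ord0 ord0)) (D 0 (cubic_index ord0 ord0 (inord 1))).
have cE (y : 'rV[K]_2) y2 w : c (double_plane_point y y2 w) = y 0 0 ^+ 2 *: y.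
  rewrite /c !double_plane_pointE point3_0 point3_1 [in RHS](pair2_eta y) pair2_0 pair2Z.
  by congr pair2; ring.
have hc : form_map 1 c.
  move=> i; have [->|->] := ord2_cases i.
  - by apply: form_ext (form_coord K _) _ => D; rewrite pair2_0.
  - by apply: form_ext (form_coord K _) _ => D; rewrite pair2_1.
have hG : is_form (1 + e * 1) (fun D => D 0 (cubic_index ord0 ord0 ord0) * B (c D)).
  exact: formM (form_coord K _) (form_comp hB hc).
have [|D D' [_ GD]] := dns _ (form_open DP hG).
  have [w hD] := double_plane_over 1 (row_neq0 s0).
  exists (double_plane_point s 1 w); split=> //.
  rewrite cE double_plane_pointE point3_0 (form_scale _ _ hB).
  by rewrite !mulf_neq0 // !expf_neq0.
have Uz : UX0 (piV D) := morphism_maps mpiV D'.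
exists (piV D); first by case: oUX0 => UX0X _; exact: UX0X.
have [DPD _] := oDP'; have [y [y2 [w [_ _ yD]]]] := DPD _ D'.
have := same_form hG (same_sym yD) GD.
rewrite cE double_plane_pointE point3_0 (form_scale _ _ hB) !mulf_eq0 !negb_or.
case/andP=> /andP[y0 _] /andP[_ By]; apply: same_form hB _ By.
by apply: fE Uz (row_neq0 y0) (same_trans yD (piK D D')).
Qed.

Lemma UC_open : locally_open C UC.
Proof. exact: curve_domain_open oUC0 invC. Qed.

Lemma fibre_product_dense e (Q : 'rV[K]_(n * m) -> K) : is_form e Q ->
  (forall z c, UX z -> UC c -> same_point (f z) (h c) -> Q (segre z c) = 0) ->
  forall z c, X z -> C c -> same_point (f z) (h c) -> Q (segre z c) = 0.
Proof.
have [d [g [r [U [hg r0 lift [oU neU] param]]]]] :=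
  curve_lift pE p_neq0 irrC oUC0 dMT' invC hE.
exact: fibre_product_density irrX UX_open UX_nonempty mf f_dominant irrC mh hg
  r0 lift oU neU param e Q.
Qed.

Lemma fibre_product_point :
  exists z c, [/\ UX z, UC c & same_point (f z) (h c)].
Proof.
have [d [g [r [U [hg r0 lift _ _]]]]] :=
  curve_lift pE p_neq0 irrC oUC0 dMT' invC hE.
exact: fibre_product_nonempty irrX UX_open UX_nonempty mf f_dominant r0 lift.
Qed.

Lemma UX_coordinates z u : UX z -> same_point (pair2 1 u) (f z) ->
  exists y2 w, [/\ y2 != 0, w ^+ 2 = y2 * (u * y2 ^+ 3 + p.[u]) &
    same_point (double_plane_point (pair2 1 u) y2 w) (pi z)].
Proof.
move=> [Uz [D' cD]] uf.
have [oDP' _] := dense_openP (@double_plane_nonzero K F2 F5) dDP'.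
have [DPD _] := oDP'; have [y [y2 [w [_ eq yD]]]] := DPD _ D'.
have := same_form c002_form (same_sym yD) cD.
rewrite c002E mulf_eq0 negb_or expf_eq0 /= => /andP[y0 y20].
have [s s0 yE] := same_trans uf (same_sym (fE Uz (row_neq0 y0) yD)).
exists (y2 / s), (w / s ^+ 3); split; first by rewrite mulf_neq0 // invr_eq0.
  move: eq; rewrite yE (F5_pencil hF5 pE) (F2_value F2E) pair2Z pair2_0 pair2_1 => eq.
  have -> : (w / s ^+ 3) ^+ 2 = w ^+ 2 / s ^+ 6 by field.
  by rewrite eq; field.
apply: same_trans yD; exists (s ^+ 3); first by rewrite expf_neq0.
by rewrite -double_plane_pointZ yE; congr double_plane_point; field.
Qed.

Let UXcone : cone UX := locally_open_cone cX UX_open.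
Let UCcone : cone UC := locally_open_cone cC UC_open.
Let nZ : nonzero_set Z.
Proof. by move=> z [x [c [Xx Cc _ ->]]]; rewrite segre_neq0 nX ?nC. Qed.
Let nE : nonzero_set E := @weierstrass_nonzero K 0 (beta ^+ 6).
Let cE : cone E := @weierstrass_cone K 0 (beta ^+ 6).
Let nCE : nonzero_set CE := prod_nonzero nC nE.

Let fstZ : morphism Z X (@fst_point K n m).
Proof.
apply: morphism_restrict (fst_morphism nX nC cX) _ _ => z [x [c [Xx Cc _ ->]]].
  by exists x, c.
exact: cX (fst_pointP (nX Xx) (nC Cc)) Xx.
Qed.

Let sndZ : morphism Z C (@snd_point K n m).
Proof.
apply: morphism_restrict (snd_morphism nX nC cC) _ _ => z [x [c [Xx Cc _ ->]]].
  by exists x, c.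
exact: cC (snd_pointP (nX Xx) (nC Cc)) Cc.
Qed.

Let fstCE := fst_morphism nC nE cC.
Let sndCE := snd_morphism nC nE cE.

Let U := [set z | (Z z /\ UX (fst_point z)) /\ (Z z /\ UC (snd_point z))].

Let in_U z c : UX z -> UC c -> same_point (f z) (h c) -> U (segre z c).
Proof.
move=> Uz Uc fh; have [UXX _] := UX_open; have [UCC _] := UC_open.
have z0 := nX (UXX z Uz); have c0 := nC (UCC c Uc).
have Zzc : Z (segre z c) by exists z, c; split; auto.
split; split=> //; first exact: UXcone (fst_pointP z0 c0) Uz.
exact: UCcone (snd_pointP z0 c0) Uc.
Qed.

Let U_factors z : U z -> let P := fst_point z in let c := snd_point z in
  [/\ UX P, UC c, same_point (f P) (h c) & same_point (segre P c) z].
Proof.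
move=> [[[x [c [Xx Cc fh ->]]] UP] [_ Uc]] P c'.
have x0 := nX Xx; have c0 := nC Cc.
have xP := fst_pointP x0 c0; have cc' := snd_pointP x0 c0.
split=> //; last exact: same_sym (same_segre xP cc').
have [UXX _] := UX_open; have [UCC _] := UC_open.
apply: same_trans (same_sym (morphism_same mf Xx (UXX _ UP) xP)) _.
exact: same_trans fh (morphism_same mh Cc (UCC _ Uc) cc').
Qed.

(** An open set missing [U] would contain the nonvanishing locus of a form that vanishes on all good
    pairs, hence on the whole pull-back by [fibre_product_dense]. *)
Let U_dense : dense_open Z U.
Proof.
split; first apply/(open_inP _ nZ).
  exact: locally_openI (preimage_open fstZ UX_open) (preimage_open sndZ UC_open).
move=> W /(open_inP _ nZ)[WZ hW] [z0 Wz0].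
have [d [Q [hQ Qz0 QW]]] := hW z0 Wz0.
apply: contrapT => nUW; have [x [c [Xx Cc fh z0E]]] := WZ z0 Wz0.
case/eqP: Qz0; rewrite z0E; apply: (fibre_product_dense hQ) => // z c' Uz Uc fh'.
apply/eqP/negbNE/negP => Qzc; apply: nUW; exists (segre z c').
have Uzc := in_U Uz Uc fh'; split=> //; apply: QW => //.
by case: Uzc => [[]].
Qed.

Let off_lines (e : 'rV[K]_3) := e 0 ord0 * e 0 i2.
Let off_lines_form : is_form 2 off_lines.
Proof. exact: formM (form_coord K _) (form_coord K _). Qed.

Let E0 := [set e | E e /\ off_lines e != 0].
Let E0open : locally_open E E0 := form_open E off_lines_form.
Let E0cone : cone E0 := locally_open_cone cE E0open.
Let O := [set z | (CE z /\ UC (fst_point z)) /\ (CE z /\ E0 (snd_point z))].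

(** On [O] this lands in the double plane, but possibly outside [DP'], where [piV] is not
    controlled; hence the further restriction in [U']. *)
Let theta (z : 'rV[K]_(m * 3)) : 'rV[K]_(3 * (3 * 3) + 1) :=
  plane_map beta (segre (kappa (fst_point z)) (snd_point z)).

Let U' := [set z | O z /\ DP' (theta z)].

Let in_O c e : UC c -> E0 e -> O (segre c e).
Proof.
move=> Uc Ee; have [UCC _] := UC_open.
have c0 := nC (UCC c Uc); have e0 : e != 0 by case: Ee => /nE.
have CEce : CE (segre c e) by exists c, e; split; [exact: UCC|case: Ee|].
split; split=> //; first exact: UCcone (fst_pointP c0 e0) Uc.
exact: E0cone (snd_pointP c0 e0) Ee.
Qed.

Let O_factors z : O z -> same_point (segre (fst_point z) (snd_point z)) z.
Proof.
move=> [[[c [e [Cc Ee ->]]] _] _]; apply: same_sym.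
have c0 := nC Cc; have e0 := nE Ee.
by apply: same_segre; [exact: fst_pointP|exact: snd_pointP].
Qed.

Let plane_map_same z z' : same_point z z' ->
  same_point (plane_map beta z) (plane_map beta z').
Proof. exact: same_form_map (@plane_map_form K beta). Qed.

Let cubic_map_same z z' : same_point z z' ->
  same_point (cubic_map beta z) (cubic_map beta z').
Proof. exact: same_form_map (@cubic_map_form K beta). Qed.

Let E0_coordinates e : E0 e ->
  exists x y w, [/\ e = point3 x y w, x != 0, w != 0 & E (point3 x y w)].
Proof.
move=> [Ee]; rewrite /off_lines mulf_eq0 negb_or => /andP[x0 w0].
exists (e 0 ord0), (e 0 (inord 1)), (e 0 (inord 2)).
by rewrite -point3E; split=> //.
Qed.

Let UC_in_UC0 c : UC c -> UC0 c. Proof. by case. Qed.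
Let UX_in_UX0 z : UX z -> UX0 z. Proof. by case. Qed.
Let UC_in_C c : UC c -> C c. Proof. by have [UCC _] := UC_open; exact: UCC. Qed.

Let O_double_plane z : O z -> DP (theta z).
Proof.
move=> [[_ Uc] [_ Ee]].
have [v [x [vx v0 x0 Mc _]]] := curve_domain_coordinates pE dMT' hE Uc.
have [X1 [Y1 [W1 [eE X0 W0 Ee1]]]] := E0_coordinates Ee.
have DPp := plane_map_double_plane beta0 F2E hF5 pE vx v0 W0 Ee1.
apply: double_plane_cone DPp; apply: plane_map_same.
by rewrite /theta eE; apply: same_segre Mc (same_refl _).
Qed.

Let theta_morphism : morphism O DP theta.
Proof.
have [mk _ _ _] := invC.
have mfst : morphism O UC0 (@fst_point K m 3).
  apply: morphism_restrict fstCE _ _ => z [[]] //.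
  by move=> _ Uc _; exact: UC_in_UC0.
have msnd : morphism O E (@snd_point K m 3).
  apply: morphism_restrict sndCE _ _ => z [[]] //.
  by move=> _ _ [_ []].
(* The composite is factored through its own image, since [plane_map] is known to land in the double
   plane only on such vectors. *)
pose S := [set t | exists2 z, O z & t = segre (kappa (fst_point z)) (snd_point z)].
have mS : morphism O S (fun z => segre (kappa (fst_point z)) (snd_point z)).
  apply: morphism_restrict (pair_morphism (morphism_comp mfst mk) msnd) _ _ => //.
  by move=> z Oz; exists z.
apply: morphism_comp mS (form_morphism (@plane_map_form K beta) _ _).
  exact: double_plane_nonzero.
by move=> _ [z Oz ->]; exact: O_double_plane.
Qed.

Let O_open : locally_open CE O.
Proof.
exact: locally_openI (preimage_open fstCE UC_open) (preimage_open sndCE E0open).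
Qed.

Let U'_open : locally_open CE U'.
Proof.
have [oDP' _] := dense_openP (@double_plane_nonzero K F2 F5) dDP'.
exact: locally_open_trans O_open (preimage_open theta_morphism oDP').
Qed.

Let DP'cone : cone DP'.
Proof.
have [oDP' _] := dense_openP (@double_plane_nonzero K F2 F5) dDP'.
exact: locally_open_cone (@double_plane_cone K F2 F5) oDP'.
Qed.

Let theta_segre c e : UC c -> E0 e ->
  same_point (plane_map beta (segre (kappa c) e)) (theta (segre c e)).
Proof.
move=> Uc Ee; have [mk _ _ _] := invC.
have Oce := in_O Uc Ee; have c0 := nC (UC_in_C Uc).
have e0 : e != 0 by case: Ee => /nE.
apply: plane_map_same; apply: same_segre; last exact: snd_pointP.
apply: morphism_same mk (UC_in_UC0 Uc) _ (fst_pointP c0 e0).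
by case: Oce => [[_ /UC_in_UC0]].
Qed.

Let eta (z : 'rV[K]_(n * m)) : 'rV[K]_3 :=
  cubic_map beta (segre (pi (fst_point z)) (kappa (snd_point z))).

Let U_normal_form z : U z -> exists y2 w v x,
  let D := double_plane_point (pair2 1 (x ^+ 2)) y2 w in let M := point3 1 v x in
  [/\ [/\ on_curve p v x, v != 0, x != 0 & y2 != 0],
    w ^+ 2 = y2 * (x ^+ 2 * y2 ^+ 3 + p.[x ^+ 2]),
    same_point D (pi (fst_point z)), same_point M (kappa (snd_point z)) &
    same_point (cubic_map beta (segre D M)) (eta z)].
Proof.
move=> /U_factors[Uz Uc fh _].
have [v [x [vx v0 x0 Mc xh]]] := curve_domain_coordinates pE dMT' hE Uc.
have [y2 [w [y20 eq Dz]]] := UX_coordinates Uz (same_trans xh (same_sym fh)).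
exists y2, w, v, x; split=> //.
by apply: cubic_map_same; exact: same_segre.
Qed.

Let eta_E0 z : U z -> E0 (eta z).
Proof.
move=> /U_normal_form[y2 [w [v [x [[vx v0 x0 y20] eq _ _ De]]]]].
apply: E0cone De _; split; first exact: cubic_map_weierstrass vx x0 y20 eq.
rewrite /off_lines cubic_mapE pair2_0 point3_0 point3_2 expr1n !mul1r.
by rewrite !mulf_neq0 // expf_neq0.
Qed.

Let theta_eta z : U z ->
  same_point (pi (fst_point z)) (theta (segre (snd_point z) (eta z))).
Proof.
move=> Uz; have [_ Uc _ _] := U_factors Uz.
have [y2 [w [v [x [[vx v0 x0 y20] eq Dz Mc De]]]]] := U_normal_form Uz.
apply: same_trans (same_sym Dz) _.
apply: same_trans (plane_map_cubic_map w beta0 v0 x0 y20) _.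
apply: same_trans _ (theta_segre Uc (eta_E0 Uz)).
by apply: plane_map_same; exact: same_segre.
Qed.

Let phi z := segre (snd_point z) (eta z).
Let psi z := segre (piV (theta z)) (fst_point z).

Let phi_maps z : U z -> U' (phi z).
Proof.
move=> Uz; have [[_ [D' _]] Uc _ _] := U_factors Uz.
by split; [exact: in_O Uc (eta_E0 Uz)|exact: DP'cone (theta_eta Uz) D'].
Qed.

Let theta_normal_form z : U' z -> exists v x X1 Y1 W1 (k : K),
  let D := plane_map beta (segre (point3 1 v x) (point3 X1 Y1 W1)) in
  [/\ [/\ v != 0, x != 0, X1 != 0, W1 != 0 & snd_point z = point3 X1 Y1 W1],
    same_point (point3 1 v x) (kappa (fst_point z)),
    same_point (pair2 1 (x ^+ 2)) (h (fst_point z)) &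
    same_point D (theta z)].
Proof.
move=> [[[_ Uc] [_ Ee]] _].
have [v [x [vx v0 x0 Mc xh]]] := curve_domain_coordinates pE dMT' hE Uc.
have [X1 [Y1 [W1 [eE X0 W0 Ee1]]]] := E0_coordinates Ee.
exists v, x, X1, Y1, W1, 0; split=> //; apply: plane_map_same.
by rewrite eE; exact: same_segre Mc (same_refl _).
Qed.

Let psi_factors z : U' z ->
  UX (piV (theta z)) /\ same_point (f (piV (theta z))) (h (fst_point z)).
Proof.
move=> U'z; have [mpi mpiV _ piK] := invX; have [_ D'] := U'z.
have [v [x [X1 [Y1 [W1 [_ [[v0 x0 X0 W0 _] _ xh]]]]]]] := theta_normal_form U'z.
rewrite plane_mapE; set y := _ *: _; set y2 := beta ^+ 2 * _; set w := beta * _ => Dth.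
have s0 : x * X1 * W1 ^+ 2 != 0 by rewrite !mulf_neq0 // expf_neq0.
have y00 : y 0 0 != 0 by rewrite /y pair2Z pair2_0 mulr1.
have Uz : UX0 (piV (theta z)) := morphism_maps mpiV D'.
have Dpi := same_trans Dth (piK _ D').
split; last first.
  apply: same_trans (same_sym (fE Uz (row_neq0 y00) Dpi)) _.
  exact: same_trans (same_sym (same_scale _ s0)) xh.
split=> //; split; first exact: morphism_maps mpi Uz.
apply: same_form c002_form Dpi _.
by rewrite c002E !mulf_neq0 ?expf_neq0.
Qed.

Let psi_maps z : U' z -> U (psi z).
Proof.
move=> U'z; have [Uz fh] := psi_factors U'z.
by apply: in_U => //; case: U'z => [[[]]].
Qed.

Let eta_morphism : morphism U E eta.
Proof.
have [mpi _ _ _] := invX; have [mk _ _ _] := invC.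
have mfst : morphism U UX0 (@fst_point K n m).
  by apply: morphism_restrict fstZ _ _ => z [[]] // _ /UX_in_UX0.
have msnd : morphism U UC0 (@snd_point K n m).
  by apply: morphism_restrict sndZ _ _ => z [[]] // _ _ [_ /UC_in_UC0].
pose S := [set t | exists2 z, U z &
  t = segre (pi (fst_point z)) (kappa (snd_point z))].
have mS : morphism U S (fun z => segre (pi (fst_point z)) (kappa (snd_point z))).
  apply: morphism_restrict (pair_morphism (morphism_comp mfst mpi)
    (morphism_comp msnd mk)) _ _ => //.
  by move=> z Uz; exists z.
apply: morphism_comp mS (form_morphism (@cubic_map_form K beta) nE _).
by move=> _ [z Uz ->]; have [] := eta_E0 Uz.
Qed.

Let phi_morphism : morphism U U' phi.
Proof.
have msnd : morphism U C (@snd_point K n m).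
  by apply: morphism_restrict sndZ _ _ => z [[]] // _ _ [_ /UC_in_C].
exact: morphism_restrict (pair_morphism msnd eta_morphism) _ phi_maps.
Qed.

Let psi_morphism : morphism U' U psi.
Proof.
have [_ mpiV _ _] := invX.
have mth : morphism U' DP' theta.
  by apply: morphism_restrict theta_morphism _ _ => z [].
have mfst : morphism U' C (@fst_point K m 3).
  by apply: morphism_restrict fstCE _ _ => z [[[]]] // _ /UC_in_C.
exact: morphism_restrict (pair_morphism (morphism_comp mth mpiV) mfst) _ psi_maps.
Qed.

Let psi_phi z : U z -> same_point z (psi (phi z)).
Proof.
move=> Uz; have [UP Uc _ zE] := U_factors Uz; have [mpi mpiV piVK _] := invX.
have U'p := phi_maps Uz; have eta0 : eta z != 0 by case: (eta_E0 Uz) => /nE.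
apply: same_trans (same_sym zE) _; apply: same_segre.
  apply: same_trans (piVK _ (UX_in_UX0 UP)) _.
  apply: morphism_same mpiV _ _ (theta_eta Uz); last by case: U'p.
  exact: morphism_maps mpi (UX_in_UX0 UP).
exact: fst_pointP (nC (UC_in_C Uc)) eta0.
Qed.

Let phi_psi z : U' z -> same_point z (phi (psi z)).
Proof.
move=> U'z; have [UP fh] := psi_factors U'z; have [mpi mpiV _ piK] := invX.
have [mk _ _ _] := invC; have Up := psi_maps U'z.
have [[_ Uc] [_ Ee]] : O z by case: U'z.
have [UXX _] := UX_open.
have P0 := nX (UXX _ UP); have c0 := nC (UC_in_C Uc).
have [UPp Ucp _ _] := U_factors Up.
apply: same_trans (same_sym (O_factors _)) _; first by case: U'z.
apply: same_segre; first exact: snd_pointP P0 c0.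
have [v [x [X1 [Y1 [W1 [_ [[v0 x0 X0 W0 eE] Mc _ Dth]]]]]]] := theta_normal_form U'z.
rewrite eE; apply: same_trans (cubic_map_plane_map Y1 beta0 v0 x0 X0 W0) _.
apply: cubic_map_same; apply: same_segre.
  apply: same_trans Dth (same_trans (piK _ _) _); first by case: U'z.
  exact: morphism_same mpi (UX_in_UX0 UP) (UX_in_UX0 UPp) (fst_pointP P0 c0).
apply: same_trans Mc _.
exact: morphism_same mk (UC_in_UC0 Uc) (UC_in_UC0 Ucp) (snd_pointP P0 c0).
Qed.

(** On the product side density is immediate: [CE] is irreducible, so the open set [U'] needs only
    one point, the image of a good pair. *)
Lemma pullback_birational : birational Z CE.
Proof.
exists U, phi; split; first exact: U_dense.
exists U'; last first.
  exists psi; split; [exact: phi_morphism | exact: psi_morphism |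
    exact: psi_phi | exact: phi_psi].
apply: irreducible_dense nCE _ U'_open _.
  exact: prod_irreducible irrC (@weierstrass_irreducible K (beta ^+ 6)).
have [z [c [Uz Uc fh]]] := fibre_product_point.
by exists (phi (segre z c)); exact: phi_maps (in_U Uz Uc fh).
Qed.

End Assembly.

Lemma j_invariant_eq0 (K : numClosedFieldType) (a b : K) :
  weierstrass_disc a b != 0 -> j_invariant a b = 0 -> a = 0 /\ b != 0.
Proof.
rewrite /j_invariant => disc0 /eqP.
rewrite mulf_eq0 invr_eq0 (negPf disc0) orbF mulf_eq0 oppr_eq0 pnatr_eq0 /=.
rewrite expf_eq0 mulf_eq0 pnatr_eq0 /= => /eqP a0; split=> //.
apply: contraNneq disc0 => b0.
by rewrite /weierstrass_disc a0 b0 !expr0n /= !mulr0 addr0 mulr0.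
Qed.

Local Open Scope complex_scope.

Theorem proposition4p15 (R : realType)
  (G : {mpoly R[i][4]}) (L M : 'M[R[i]]_(2, 4)) (F2 F5 : {mpoly R[i][2]})
  (hS : smooth_cubic_surface G) (hl : line_on G L)
  (hM : pencil_coordinates L M) (hF : pencil_forms G L M F2 F5)
  (hF2 : F2 = 'X_0 * 'X_1)
  (n : nat) (X : set 'rV[R[i]]_n) (f : 'rV[R[i]]_n -> 'rV[R[i]]_2)
  (hX : elliptic_K3 F2 F5 X f)
  (m : nat) (C : set 'rV[R[i]]_m) (h : 'rV[R[i]]_m -> 'rV[R[i]]_2)
  (hC : Matsumoto_Terasoma F5 C h)
  (a b : R[i]) (hE : weierstrass_disc a b != 0) (hj : j_invariant a b = 0) :
  birational (pullback X f C h) (prod_variety C (weierstrass_cubic a b)).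
Proof.
have [a0 b0] := j_invariant_eq0 hE hj; rewrite {}a0 {a hE hj}.
pose beta : R[i] := 6.-root b; have betaE : beta ^+ 6 = b by rewrite rootCK.
have beta0 : beta != 0 by apply: contraNneq b0 => b0; rewrite -betaE b0 expr0n.
have [_ [hF5 F50 _]] := hF.
have [p p0 pE] := dehomogenized_quintic hF5 F50.
have [[[cX irrX _] _] mf [UX [pi [[dUX [DP' dDP' [piV invX]]] fE]]]] := hX.
have [[cC irrC _] mh [UC [kappa [[dUC [MT' dMT' [kappaV invC]]] hE]]]] := hC.
have nX := proj_closed_nonzero cX; have nC := proj_closed_nonzero cC.
have [oUX _] := dense_openP nX dUX; have [oUC _] := dense_openP nC dUC.
rewrite -betaE.
apply: (pullback_birational hF2 hF5 pE p0 beta0 nX (proj_closed_cone cX)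
  (irreducible_form nX irrX) mf oUX dDP' invX _ nC (proj_closed_cone cC)
  (irreducible_form nC irrC) mh oUC dMT' invC) => [z y y2 w|c v x].
  exact: fE.
exact: hE.
Qed.
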